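(* Let $d\ge 1$ and let $\mathcal{L}_1,\mathcal{L}_2\in \mathrm{Mat}_d(\mathbb{Z})$ be irreducible and coprime. Then there are constants $D>0$ and $\sigma>0$ such that, for every finite subset $A$ of $\mathbb{Z}^d$, $$|\mathcal{L}_1 A+\mathcal{L}_2 A|\geq \left(|\det(\mathcal{L}_1)|^{1/d}+|\det(\mathcal{L}_2)|^{1/d}\right)^d|A|-D|A|^{1-\sigma}.$$ Moreover, the constants $D,\sigma$ can be chosen depending only on $d$, $|\det\mathcal{L}_1|$ and $|\det\mathcal{L}_2|$.
   Context: For a matrix $\mathcal{L}$ and a set $A$, $\mathcal{L}A=\{\mathcal{L}a: a\in A\}$, and $X+Y=\{x+y:x\in X,y\in Y\}$. Matrices $\mathcal{L}_1,\ldots,\mathcal{L}_k\in\mathrm{Mat}_d(\mathbb{Z})$ are called irreducible if there are no non-trivial subspaces $U,V$ of $\mathbb{Q}^d$ of the same dimension such that $\mathcal{L}_iU\subseteq V$ for all $i$ (non-trivial meaning neither $\{0\}$ nor $\mathbb{Q}^d$). They are called coprime if there are no $\mathcal{P},\mathcal{Q}\in \mathrm{GL}_d(\mathbb{Q})$ with $0<|\det(\mathcal{P})\det(\mathcal{Q})|<1$ such that $\mathcal{P}\mathcal{L}_i\mathcal{Q}\in\mathrm{Mat}_d(\mathbb{Z})$ for all $i$. *)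

(* Defs.v *)
From HB Require Import structures.
From mathcomp Require Import all_boot all_order all_algebra.
From mathcomp Require Import finmap.
From mathcomp Require Import all_classical all_reals all_analysis.
Set Implicit Arguments. Unset Strict Implicit. Unset Printing Implicit Defensive.
Import Order.TTheory GRing.Theory Num.Theory.
Local Open Scope ring_scope.

Definition ratmx (m n : nat) (A : 'M[int]_(m, n)) : 'M[rat]_(m, n) :=
  map_mx (fun z : int => z%:~R) A.

(* Irreducibility of a family of integer d x d matrices (acting on column
   vectors of Q^d).  A subspace U of Q^d is encoded as the row space of a
   matrix U : 'M[rat]_d, i.e. the column vectors u^T for rows u of U; then
   L U = { L u^T } corresponds to the row space of U *m L^T. *)
Definition irreducible_mats (d : nat) (Ls : seq 'M[int]_d) : Prop :=
  ~ exists U V : 'M[rat]_d,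
      [/\ (0 < \rank U)%N, (\rank U < d)%N, \rank U = \rank V &
          forall L, L \in Ls -> (U *m (ratmx L)^T <= V)%MS].

Definition coprime_mats (d : nat) (Ls : seq 'M[int]_d) : Prop :=
  ~ exists P Q : 'M[rat]_d,
      [/\ P \in unitmx, Q \in unitmx,
          0 < `|\det P * \det Q|, `|\det P * \det Q| < 1 &
          forall L, L \in Ls -> exists M : 'M[int]_d, P *m ratmx L *m Q = ratmx M].

Definition lin_sumset (d : nat) (L1 L2 : 'M[int]_d) (A : {fset 'cV[int]_d})
  : {fset 'cV[int]_d} :=
  [fset (L1 *m a + L2 *m b)%R | a in A, b in A]%fset.

(* Main.v *)
Require Import Defs.
From HB Require Import structures.
From mathcomp Require Import all_boot all_order all_algebra.
From mathcomp Require Import finmap zify ring lra.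
From mathcomp Require Import all_classical all_reals all_analysis.
Set Implicit Arguments. Unset Strict Implicit. Unset Printing Implicit Defensive.
Import Order.TTheory GRing.Theory Num.Theory.
Local Open Scope ring_scope.

(** Put [g = L1^-1 L2] (acting on rows), so that [|L1 A + L2 A| = |A + A g|], and let [K] be the
    constant of the theorem.

    If [|A + A g| <= K |A|], sumset calculus covers [2 (A - A)] and [(A - A) g] by boundedly many
    translates of [A - A].  Recording which translates are used along repeated doubling, a
    pigeonhole gives [v <> 0] with [2^i v g^s] in [(A - A) - (A - A)] for all [s <= d] and
    [2^i <= |A|^c].  By irreducibility the [v g^s] contain a basis, and in each direction of this
    basis [A + A g] is covered by at most [|A|^(1 - c')] lines.  A discrete Brunn-Minkowski
    inequality, whose error terms count such lines, therefore holds for [X + Y g] with any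
    [X], [Y] inside [A].

    Now let [A] be a minimal counterexample.  For a subgroup [Gamma] containing [A - A] and a class
    [C] of the relation [(a - b) g \in Gamma] on [A], the sets [A + C g] and
    [(A \ C) + (A \ C) g] are disjoint, so minimality bounds [|A + C g|] by about [K |C|].  Hence all
    classes have size comparable with [A], and [A + C g] hardly exceeds [C + C g].  The
    latter forces [C] to meet every class at the next level, and coprimality says that there are at
    least [|det L1|] of them; the same works for [g^-1] and [|det L2|].  For the smallest
    class [J] of one kind and [I] of the other, Brunn-Minkowski on the disjoint pieces then
    gives both [|det L2| |I| < |det L1| |J|] and the reverse inequality. *)

(** * Sumsets *)

(** Counted by cardinality, Brunn-Minkowski for [A] and [A g] gives no more than [2^d |A|]; the rest
    of [K] is arithmetic. With [m1], [m2] the two [|det|], suppose that [A] splits into [m2] classes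
    modulo [Gamma g] and [A g] into [m1] classes modulo [Gamma], all of equal size. The [m1 m2]
    partial sums are disjoint, and Brunn-Minkowski for each of them adds up to [m1 m2
    ((|A|/m2)^(1/d) + (|A|/m1)^(1/d))^d = K |A|]. The classes of an arbitrary set need be neither
    that numerous nor equal. Minimality repairs both: the residues are filled after one passage to a
    class, and instead of averaging over all classes one compares [|A + J g|] with [K |J|] for a
    single smallest [J]. Each passage multiplies the relative loss by a factor of order [K]; with
    two passages and the final comparison, the exponent has to stay below [1 / (28 K^3)]. *)

Definition sumset (V : zmodType) (A B : {fset V}) : {fset V} :=
  [fset (a + b)%R | a in A, b in B]%fset.

Definition diffset (V : zmodType) (A B : {fset V}) : {fset V} :=
  [fset (a - b)%R | a in A, b in B]%fset.

Fixpoint nsumset (V : zmodType) (n : nat) (A : {fset V}) : {fset V} :=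
  if n is n'.+1 then sumset A (nsumset n' A) else [fset 0%R]%fset.

Lemma card_le_inj (T U : choiceType) (f : T -> U) (A : {fset T}) (B : {fset U}) :
  {in A &, injective f} -> (forall x, x \in A -> f x \in B) ->
  (#|` A| <= #|` B|)%N.
Proof.
move=> fI fAB.
have <- : #|` [fset f x | x in A]%fset| = #|` A| by apply: card_in_imfset.
apply: fsubset_leq_card; apply/fsubsetP => y /imfsetP [x /= xA ->]; exact: fAB.
Qed.

Lemma card_le_prod (T U W : choiceType) (f : T -> U -> W)
    (A : {fset T}) (B : {fset U}) (C : {fset W}) :
  (forall z, z \in C -> exists x y, [/\ x \in A, y \in B & z = f x y]) ->
  (#|` C| <= #|` A| * #|` B|)%N.
Proof.
move=> h.
pose s := [seq f x y | x <- A, y <- B].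
have -> : (#|` A| * #|` B|)%N = size s by rewrite size_allpairs.
apply: uniq_leq_size; first exact: fset_uniq.
move=> z /h [x [y [xA yB ->]]]; exact: allpairs_f.
Qed.

Lemma card_ge_prod (T U W : choiceType) (f : T -> U -> W)
    (A : {fset T}) (B : {fset U}) (C : {fset W}) :
  (forall x y, x \in A -> y \in B -> f x y \in C) ->
  (forall x y x' y', x \in A -> y \in B -> x' \in A -> y' \in B ->
     f x y = f x' y' -> x = x' /\ y = y') ->
  (#|` A| * #|` B| <= #|` C|)%N.
Proof.
move=> fC fI.
pose s := [seq f x y | x <- A, y <- B].
have <- : size s = (#|` A| * #|` B|)%N by rewrite size_allpairs.
apply: uniq_leq_size; last first.
  by move=> z /allpairsP [[x y] /= [xA yB ->]]; exact: fC.
apply: allpairs_uniq; try exact: fset_uniq.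
move=> [x y] [x' y'] /allpairsP [[? ?] /= [h1 h2 [-> ->]]].
move=> /allpairsP [[? ?] /= [h3 h4 [-> ->]]] e.
by have [-> ->] := fI _ _ _ _ h1 h2 h3 h4 e.
Qed.

Section Sumsets.
Variable V : zmodType.
Implicit Types (A B C X Y Z S : {fset V}) (x y z : V).
Local Open Scope nat_scope.

Lemma sumsetP A B z :
  reflect (exists a b, [/\ a \in A, b \in B & z = a + b]%R) (z \in sumset A B).
Proof.
apply: (iffP idP) => [/imfset2P [a aA [b bB ->]]|[a [b [aA bB ->]]]].
  by exists a, b.
by apply/imfset2P; exists a => //; exists b.
Qed.

Lemma diffsetP A B z :
  reflect (exists a b, [/\ a \in A, b \in B & z = a - b]%R) (z \in diffset A B).
Proof.
apply: (iffP idP) => [/imfset2P [a aA [b bB ->]]|[a [b [aA bB ->]]]].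
  by exists a, b.
by apply/imfset2P; exists a => //; exists b.
Qed.

Lemma mem_sumset A B a b : a \in A -> b \in B -> (a + b)%R \in sumset A B.
Proof. by move=> aA bB; apply/sumsetP; exists a, b. Qed.

Lemma mem_diffset A B a b : a \in A -> b \in B -> (a - b)%R \in diffset A B.
Proof. by move=> aA bB; apply/diffsetP; exists a, b. Qed.

Lemma sumsetC A B : sumset A B = sumset B A.
Proof.
by apply/fsetP => z; apply/sumsetP/sumsetP => -[a [b [aA bB ->]]];
  exists b, a; rewrite addrC.
Qed.

Lemma sumsetA A B C : sumset A (sumset B C) = sumset (sumset A B) C.
Proof.
apply/fsetP => z; apply/sumsetP/sumsetP.
- move=> [a [? [aA /sumsetP [b [c [bB cC ->]]] ->]]].
  by exists (a + b)%R, c; rewrite addrA; split=> //; apply: mem_sumset.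
- move=> [? [c [/sumsetP [a [b [aA bB ->]]] cC ->]]].
  by exists a, (b + c)%R; rewrite addrA; split=> //; apply: mem_sumset.
Qed.

Lemma sumsetS A B A' B' :
  (A `<=` A' -> B `<=` B' -> sumset A B `<=` sumset A' B')%fset.
Proof.
move=> /fsubsetP sA /fsubsetP sB; apply/fsubsetP => z /sumsetP [a [b [aA bB ->]]].
by apply: mem_sumset; [apply: sA | apply: sB].
Qed.

Lemma diffsetS A B A' B' :
  (A `<=` A' -> B `<=` B' -> diffset A B `<=` diffset A' B')%fset.
Proof.
move=> /fsubsetP sA /fsubsetP sB; apply/fsubsetP => z /diffsetP [a [b [aA bB ->]]].
by apply: mem_diffset; [apply: sA | apply: sB].
Qed.

Lemma card_sumset_le A B : #|` sumset A B| <= #|` A| * #|` B|.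
Proof.
by apply: (@card_le_prod _ _ _ +%R) => z /sumsetP [a [b [? ? ->]]]; exists a, b.
Qed.

Lemma card_sumset_ger A B b : b \in B -> #|` A| <= #|` sumset A B|.
Proof.
move=> bB; apply: (@card_le_inj _ _ (fun a => a + b)%R).
  by move=> x y _ _; apply: addIr.
by move=> x xA; apply: mem_sumset.
Qed.

Lemma card_sumset_gel A B a : a \in A -> #|` B| <= #|` sumset A B|.
Proof. by rewrite sumsetC; apply: card_sumset_ger. Qed.

(* Ruzsa's triangle inequality, written with sums: [u - w = (u + y) - (w + y)]. *)
Lemma ruzsa_triangle A B Y :
  #|` diffset A B| * #|` Y| <= #|` sumset A Y| * #|` sumset B Y|.
Proof.
have repr z : exists p : V * V, (z \in diffset A B) ==>
    [&& p.1 \in A, p.2 \in B & z == (p.1 - p.2)%R].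
  have [/diffsetP [a [b [aA bB ->]]]|_] := boolP (z \in diffset A B); last by exists (0%R, 0%R).
  by exists (a, b); rewrite /= aA bB eqxx.
pose r z := xchoose (repr z).
have rP z : z \in diffset A B -> [/\ (r z).1 \in A, (r z).2 \in B & z = ((r z).1 - (r z).2)%R].
  by move=> zD; have /implyP/(_ zD)/and3P [? ? /eqP] := xchooseP (repr z).
pose f z y := ((r z).1 + y, (r z).2 + y)%R.
pose C := [fset ((u, w) : V * V) | u in sumset A Y, w in sumset B Y]%fset.
apply: (@leq_trans #|` C|).
  apply: (@card_ge_prod V V _ f).
    move=> z y zD yY; have [h1 h2 _] := rP _ zD.
    apply/imfset2P; exists ((r z).1 + y)%R; first exact: mem_sumset.
    by exists ((r z).2 + y)%R => //; apply: mem_sumset.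
  move=> z y z' y' zD yY zD' yY' [e1 e2].
  have [_ _ ez] := rP _ zD; have [_ _ ez'] := rP _ zD'.
  have zz : z = z'.
    have sh (p q t : V) : (p - q = (p + t) - (q + t))%R.
      by rewrite opprD addrACA subrr addr0.
    by rewrite ez ez' (sh _ _ y) e1 e2 -sh.
  by split=> //; move: e1; rewrite zz => /addrI.
by apply: (@card_le_prod _ _ _ (fun u w => (u, w))) => z /imfset2P [u uA [w wB ->]]; exists u, w.
Qed.

(** Take [Z] inside [S] maximal with the translates [z + X] pairwise disjoint. They lie in [S + X],
    so there are at most [k] of them; by maximality each [s + X] meets some [z + X], which puts [s]
    in [X - X + Z]. *)
Lemma ruzsa_cover S X k : X != fset0 -> #|` sumset S X| <= k * #|` X| ->
  exists Z, #|` Z| <= k /\ (S `<=` sumset (diffset X X) Z)%fset.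
Proof.
move=> /fset0Pn [x0 x0X] hk.
have Xgt0 : 0 < #|` X| by rewrite cardfs_gt0; apply/fset0Pn; exists x0.
pose good (Z : {fset V}) := (Z `<=` S)%fset /\
  forall z z' x x', z \in Z -> z' \in Z -> x \in X -> x' \in X ->
    (z + x = z' + x')%R -> z = z'.
have card_good Z : good Z -> #|` Z| <= k.
  move=> [/fsubsetP sZ hZ]; rewrite -(leq_pmul2r Xgt0); apply: leq_trans hk.
  apply: (@card_ge_prod _ _ _ +%R).
    by move=> z x zZ xX; apply: mem_sumset => //; apply: sZ.
  move=> z x z' x' zZ xX zZ' xX' e; have ez := hZ _ _ _ _ zZ zZ' xX xX' e.
  by split=> //; move: e; rewrite ez => /addrI.
have ext Z : good Z -> (S `<=` sumset (diffset X X) Z)%fset \/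
    exists2 Z', good Z' & #|` Z'| = #|` Z|.+1.
  move=> [/fsubsetP sZ hZ].
  have [sub|/fsubsetPn [s sS sN]] := boolP (S `<=` sumset (diffset X X) Z)%fset; first by left.
  right.
  have key z x x' : z \in Z -> x \in X -> x' \in X -> (s + x = z + x')%R -> False.
    move=> zZ xX xX' e; move/negP: sN; apply; apply/sumsetP.
    exists (x' - x)%R, z; split=> //; first exact: mem_diffset.
    by rewrite -[LHS](addrK x) e -addrA addrC.
  exists (s |` Z)%fset; last first.
    rewrite cardfsU1; case: (boolP (s \in Z)) => // sZ'.
    by case: (key s x0 x0 sZ' x0X x0X).
  split; first by rewrite fsubUset fsub1set sS; apply/fsubsetP.
  move=> z z' x x'; rewrite !in_fset1U => /orP [/eqP ->|zZ] /orP [/eqP ->|zZ'] xX xX' e //.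
  - by case: (key _ _ _ zZ' xX xX' e).
  - by case: (key _ _ _ zZ xX' xX (esym e)).
  - exact: (hZ _ _ _ _ zZ zZ' xX xX' e).
have main n Z : good Z -> k - #|` Z| <= n ->
    exists Z, #|` Z| <= k /\ (S `<=` sumset (diffset X X) Z)%fset.
  elim: n Z => [|n IH] Z gZ hn.
    case: (ext Z gZ) => [h|[Z' gZ' e]]; first by exists Z; split=> //; apply: card_good.
    by have := card_good _ gZ'; rewrite e; move: hn; lia.
  case: (ext Z gZ) => [h|[Z' gZ' e]]; first by exists Z; split=> //; apply: card_good.
  by apply: (IH Z' gZ'); rewrite e; move: hn; lia.
by apply: (main k fset0); [split; [exact: fsub0set|] | exact: leq_subr].
Qed.

(* Petridis: if [X] minimises [|X + B| / |X|], adding [C] cannot increase the ratio. *)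
Lemma petridis A B : A != fset0 -> exists X, [/\ X != fset0, (X `<=` A)%fset,
   #|` sumset X B| * #|` A| <= #|` sumset A B| * #|` X| &
   forall C, #|` sumset (sumset X B) C| * #|` X| <= #|` sumset X B| * #|` sumset X C|].
Proof.
move=> A0.
have [X [X0 XA Xmin]] : exists X, [/\ X != fset0, (X `<=` A)%fset &
   forall Z, (Z `<=` A)%fset -> #|` sumset X B| * #|` Z| <= #|` sumset Z B| * #|` X| ].
  (* The ratio [|X + B| / |X|] becomes an integer after multiplication by [|A|!], which [|X|]
     divides as [X] lies in [A]; this allows induction on it. *)
  have main n : forall X, X != fset0 -> (X `<=` A)%fset -> #|` sumset X B| * (#|` A|)`! %/ #|` X| <= n ->
     exists X, [/\ X != fset0, (X `<=` A)%fset &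
       forall Z, (Z `<=` A)%fset -> #|` sumset X B| * #|` Z| <= #|` sumset Z B| * #|` X| ].
    elim/ltn_ind: n => n IH X X0 XA hn.
    have [h|/hasPn h] := boolP (has (fun Z => #|` sumset Z B| * #|` X| < #|` sumset X B| * #|` Z|) (fpowerset A)); last first.
      exists X; split=> // Z ZA; have := h Z; rewrite fpowersetE => /(_ ZA).
      by rewrite -leqNgt.
    have [Z ZA hZ] := hasP h; rewrite fpowersetE in ZA.
    have Z0 : Z != fset0.
      by apply/eqP => e; move: hZ; rewrite e cardfs0 muln0.
    apply: (IH _ _ Z Z0 ZA (leqnn _)).
    apply: leq_trans hn.
    have dv (Y : {fset V}) : Y != fset0 -> (Y `<=` A)%fset -> #|` Y| %| (#|` A|)`!.
      move=> Y0 YA; apply: dvdn_fact; rewrite cardfs_gt0 Y0 /=; exact: fsubset_leq_card.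
    rewrite -(muln_divA _ (dv Z Z0 ZA)) -(muln_divA _ (dv X X0 XA)).
    have := dv Z Z0 ZA; have := dv X X0 XA.
    move=> /dvdnP [p ep] /dvdnP [q eq]; rewrite {1}eq ep.
    have Xp : 0 < #|` X| by rewrite cardfs_gt0.
    have Zp : 0 < #|` Z| by rewrite cardfs_gt0.
    rewrite !mulnK // -(ltn_pmul2r (_ : 0 < #|` X| * #|` Z|)); last by rewrite muln_gt0 Xp Zp.
    have pp : 0 < p.
      by case: p ep => // e; have := fact_gt0 #|` A|; rewrite e.
    have epq : q * #|` Z| = p * #|` X| by rewrite -eq -ep.
    rewrite (_ : _ * q * _ = (p * #|` X|) * (#|` sumset Z B| * #|` X|)); last by rewrite -epq; lia.
    rewrite (_ : _ * p * _ = (p * #|` X|) * (#|` sumset X B| * #|` Z|)); last by lia.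
    by rewrite ltn_pmul2l // muln_gt0 pp Xp.
  exact: (main _ A A0 (fsubset_refl A) (leqnn _)).
exists X; split=> //; first by apply: Xmin; exact: fsubset_refl.
move=> C.
elim/fset1U_rect: C => [|c C cC IH].
  by rewrite (_ : sumset (sumset X B) fset0 = fset0) ?cardfs0 //; apply/fsetP => z; apply/sumsetP => -[? [? []]].
(* [Z] collects the [x] whose whole translate [x + B + c] is already present. Adding [c] to [C]
   creates at most [|X + B| - |Z + B|] new elements of [X + B + C] and at least [|X| - |Z|] new
   elements of [X + C]; minimality of [X], tested on [Z], compares the two. *)
pose Z := [fset x in X | all (fun b => x + b + c \in sumset (sumset X B) C)%R B]%fset.
have ZX : (Z `<=` X)%fset by apply/fsubsetP => x; rewrite !inE => /andP [].
have ZBX : (sumset Z B `<=` sumset X B)%fset by apply: sumsetS => //; exact: fsubset_refl.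
have up : #|` sumset (sumset X B) (c |` C)%fset| <=
    #|` sumset (sumset X B) C| + (#|` sumset X B| - #|` sumset Z B|).
  rewrite -cardfsDS //.
  pose E := [fset (w + c)%R | w in (sumset X B `\` sumset Z B)%fset]%fset.
  have -> : #|` (sumset X B `\` sumset Z B)%fset| = #|` E|.
    by symmetry; apply: card_imfset => x y; apply: addIr.
  apply: leq_trans (leq_card_fsetU _ _); apply: fsubset_leq_card; apply/fsubsetP => z.
  move=> /sumsetP [w [e [wXB]]]; rewrite in_fset1U in_fsetU => /orP [/eqP ->|eC] ->; last first.
    by rewrite mem_sumset.
  have [wZ|wZ] := boolP (w \in sumset Z B); last first.
    by apply/orP; right; apply/imfsetP; exists w => //=; rewrite in_fsetD wZ.
  have /sumsetP [x [b [xZ bB ->]]] := wZ.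
  by move: xZ; rewrite !inE => /andP [_ /allP /(_ b bB) ->].
have lo : #|` sumset X C| + (#|` X| - #|` Z|) <= #|` sumset X (c |` C)%fset|.
  rewrite -cardfsDS //.
  pose E := [fset (w + c)%R | w in (X `\` Z)%fset]%fset.
  have -> : #|` (X `\` Z)%fset| = #|` E|.
    by symmetry; apply: card_imfset => x y; apply: addIr.
  have dj : (sumset X C `&` E)%fset = fset0.
    apply/fsetP => z; rewrite in_fsetI in_fset0; apply/negP => /andP [zXC /imfsetP [x /= xXZ ez]].
    move: xXZ; rewrite in_fsetD => /andP [/negP xZ xX]; apply: xZ.
    rewrite !inE xX /=; apply/allP => b bB.
    move: zXC; rewrite ez => /sumsetP [x' [c' [x'X c'C e]]].
    by rewrite addrAC e addrAC mem_sumset // mem_sumset.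
  rewrite -cardfsUI dj cardfs0 addn0; apply: fsubset_leq_card.
  rewrite fsubUset; apply/andP; split.
    by apply: sumsetS; [exact: fsubset_refl | exact: fsubsetU1].
  apply/fsubsetP => z /imfsetP [x /= xXZ ->]; apply: mem_sumset; last by rewrite !inE eqxx.
  by move: xXZ; rewrite in_fsetD => /andP [].
have h1 := fsubset_leq_card ZX; have h2 := fsubset_leq_card ZBX.
have h3 := Xmin Z (fsubset_trans ZX XA).
have := leq_mul up (leqnn #|` X|); have := leq_mul (leqnn #|` sumset X B|) lo.
move: IH h1 h2 h3.
move: #|` sumset _ (c |` C)%fset| #|` sumset _ (c |` C)%fset| => p q.
move: #|` sumset (sumset X B) C| #|` sumset X C| #|` sumset X B| #|` sumset Z B| #|` X| #|` Z|.
move=> xbc xc xb zb x z; nia.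
Qed.
End Sumsets.

(** * Arithmetic progressions in sets with small sumset *)

Definition apset (V : zmodType) (N : nat) (w : V) : {fset V} :=
  [fset (w *+ c)%R | c in iota 0 N]%fset.

Lemma apsetP (V : zmodType) (N : nat) (w x : V) :
  reflect (exists2 c, (c < N)%N & x = w *+ c) (x \in apset N w).
Proof.
apply: (iffP idP) => [/imfsetP [c /= ]|[c cN ->]].
  by rewrite mem_iota add0n => /andP [_ h] ->; exists c.
by apply/imfsetP; exists c => //=; rewrite mem_iota add0n cN.
Qed.

(** The maps [delta i] are read as digits. Some fibre of the last digit keeps more than [|W| ^ n]
    elements, and the induction continues inside it. *)
Lemma pigeonhole_digits (T U : choiceType) (A : {fset T}) (W : {fset U})
    (n : nat) (delta : nat -> T -> U) :
  (forall i a, (i < n)%N -> a \in A -> delta i a \in W) ->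
  (#|` W| ^ n < #|` A|)%N ->
  exists a b, [/\ a \in A, b \in A, a != b &
     forall i, (i < n)%N -> delta i a = delta i b].
Proof.
elim: n A => [|n IH] A hd.
  rewrite expn0 => hA.
  have /fset0Pn [a aA] : A != fset0 by rewrite -cardfs_gt0; apply: leq_trans hA.
  have : (0 < #|` A `\ a|%fset)%N by move: hA; rewrite (cardfsD1 a) aA.
  rewrite cardfs_gt0 => /fset0Pn [b]; rewrite in_fsetD1 => /andP [ba bA].
  by exists a, b; rewrite eq_sym.
rewrite expnS => hA.
have [/hasP [w wW hw]|/hasPn hN] := boolP (has (fun w =>
   #|` W| ^ n < #|` [fset a in A | delta n a == w]|)%fset%N W).
  case: (IH _ _ hw) => [i a iN|a [b [aA bA ab e]]].
    by rewrite !inE => /andP [aA _]; apply: hd => //; apply: ltnW.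
  move: aA bA; rewrite !inE => /andP [aA /eqP ea] /andP [bA /eqP eb].
  exists a, b; split=> // i; rewrite ltnS leq_eqVlt => /orP [/eqP ->|]; last exact: e.
  by rewrite ea eb.
exfalso; move: hA; rewrite ltnNge => /negP; apply.
rewrite [X in (X <= _)%N]card_fset_sum1 (partition_big_imfset _ (delta n)) /=.
apply: (@leq_trans (\sum_(w <- W) #|` W| ^ n)%N); last first.
  by rewrite big_const_seq count_predT iter_addn_0 mulnC.
have sub : {subset [fset delta n x | x in A]%fset <= W}.
  by move=> w /imfsetP [a /= aA ->]; apply: hd.
rewrite [X in (_ <= X)%N](big_fsetID _ (mem [fset delta n x | x in A]%fset)) /=.
apply: (@leq_trans (\sum_(i <- [fset x | x in W & x \in [fset delta n x | x in A]%fset]%fset) #|` W| ^ n)%N); last exact: leq_addr.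
rewrite (_ : [fset x | x in W & x \in [fset delta n x | x in A]%fset]%fset = [fset delta n x | x in A]%fset); last first.
  apply/fsetP => w; rewrite !inE /=; apply/andP/idP => [[]//|h]; split=> //; exact: sub.
rewrite big_seq [X in (_ <= X)%N]big_seq; apply: leq_sum => w wI.
have := hN w (sub _ wI); rewrite -leqNgt; apply: leq_trans.
by rewrite card_fset_sum1 big_fset.
Qed.

Section Structure.
Variables (V : zmodType) (f : {additive V -> V}).
Hypothesis f_inj : injective f.
Implicit Types (A B C X Y Z S W : {fset V}).
Local Open Scope nat_scope.

(** With [B = f A], iterating [petridis] gives [X] inside [A] with [|X + nB| <= kappa^n |X|]. The
    triangle inequality through [X] bounds [3B - 2B] by [kappa^5 |X|], hence also [2(A - A) + A], as
    [f] is injective; through [B] it bounds [B - B + X] by [kappa^4 |X|]. [ruzsa_cover] turns both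
    into coverings. *)
Lemma doubling_cover A kappa : A != fset0 ->
  #|` sumset A [fset f x | x in A]%fset| <= kappa * #|` A| ->
  #|` diffset A A| <= kappa ^ 2 * #|` A| /\
  exists W, [/\ #|` W| <= kappa ^ 5 + kappa ^ 4,
    (sumset (diffset A A) (diffset A A) `<=` sumset (diffset A A) W)%fset &
    forall x, x \in diffset A A -> f x \in sumset (diffset A A) W].
Proof.
move=> A0; set B := [fset f x | x in A]%fset => hT.
have cA : 0 < #|` A| by rewrite cardfs_gt0.
have cB : #|` B| = #|` A| by apply: card_imfset.
have fB x : x \in A -> f x \in B by move=> xA; apply/imfsetP; exists x.
split.
  have := ruzsa_triangle A A B; rewrite cB => h.
  by rewrite -(leq_pmul2r cA); apply: leq_trans h _; have := leq_mul hT hT; lia.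
have [X [X0 XA hX hC]] := petridis B A0.
have cX : 0 < #|` X| by rewrite cardfs_gt0.
have XB : #|` sumset X B| <= kappa * #|` X|.
  rewrite -(leq_pmul2r cA); apply: leq_trans hX _.
  by have := leq_mul hT (leqnn #|` X|); lia.
have XBC C : #|` sumset X (sumset B C)| <= kappa * #|` sumset X C|.
  rewrite sumsetA -(leq_pmul2r cX); apply: leq_trans (hC C) _.
  by have := leq_mul XB (leqnn #|` sumset X C|); lia.
have X2B : #|` sumset X (sumset B B)| <= kappa ^ 2 * #|` X|.
  by apply: leq_trans (XBC B) _; rewrite expnS expn1 -mulnA leq_mul2l XB orbT.
have X3B : #|` sumset X (sumset B (sumset B B))| <= kappa ^ 3 * #|` X|.
  by apply: leq_trans (XBC _) _; rewrite expnS -mulnA leq_mul2l X2B orbT.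
have h1 : #|` sumset (sumset (diffset A A) (diffset A A)) A| <= kappa ^ 5 * #|` A|.
  have XlA := fsubset_leq_card XA.
  apply: (@leq_trans (kappa ^ 5 * #|` X|)); last by rewrite leq_mul2l XlA orbT.
  apply: (@leq_trans #|` diffset (sumset B (sumset B B)) (sumset B B)|).
    apply: (@card_le_inj _ _ f); first by move=> x y _ _; apply: f_inj.
    move=> z /sumsetP [? [a5 [/sumsetP [? [? [/diffsetP [a1 [a2 [A1 A2 ->]]]
       /diffsetP [a3 [a4 [A3 A4 ->]]] ->]]] A5 ->]]].
    apply/diffsetP; exists (f a1 + (f a3 + f a5))%R, (f a2 + f a4)%R; split.
    - by do 2!(apply: mem_sumset; rewrite ?fB //).
    - by apply: mem_sumset; rewrite ?fB.
    - rewrite !raddfD !raddfN /= -!addrA; congr (_ + _)%R; rewrite addrCA; congr (_ + _)%R.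
      by rewrite [RHS]addrCA [(f a5 + _)%R]addrC.
  have := ruzsa_triangle (sumset B (sumset B B)) (sumset B B) X.
  rewrite ![sumset _ X]sumsetC => h.
  rewrite -(leq_pmul2r cX); apply: leq_trans h _.
  by have := leq_mul X3B X2B; rewrite (expnD kappa 3 2); lia.
have h2 : #|` sumset (diffset B B) X| <= kappa ^ 4 * #|` X|.
  have := ruzsa_triangle (sumset X B) B B.
  rewrite -(sumsetA X) => h.
  have b2 : #|` sumset B B| <= kappa ^ 2 * #|` X|.
    by have /fset0Pn [x xX] := X0; apply: leq_trans (card_sumset_gel _ xX) X2B.
  have -> : sumset (diffset B B) X = diffset (sumset X B) B.
    apply/fsetP => z; apply/sumsetP/diffsetP.
      move=> [? [x [/diffsetP [b [b' [bB bB' ->]]] xX ->]]].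
      by exists (x + b)%R, b'; split=> //; [apply: mem_sumset | rewrite addrC addrA].
    move=> [? [b' [/sumsetP [x [b [xX bB ->]]] bB' ->]]].
    by exists (b - b')%R, x; split=> //; [apply: mem_diffset | rewrite -addrA addrC].
  rewrite -(leq_pmul2r cA) -{1}cB; apply: leq_trans h _.
  apply: leq_trans (leq_mul X2B b2) _.
  have XlA := fsubset_leq_card XA.
  rewrite (expnD kappa 2 2); nia.
have [Z [cZ sZ]] := ruzsa_cover A0 h1.
have [Z1 [cZ1 sZ1]] := ruzsa_cover X0 h2.
exists (Z `|` Z1)%fset; split.
- by apply: leq_trans (leq_card_fsetU _ _) _; apply: leq_add.
- apply: fsubset_trans sZ _; apply: sumsetS; first exact: fsubset_refl.
  exact: fsubsetUl.
- move=> x /diffsetP [a [b [aA bA ->]]].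
  have sub : (sumset (diffset X X) Z1 `<=` sumset (diffset A A) (Z `|` Z1))%fset.
    by apply: sumsetS; [apply: diffsetS | exact: fsubsetUr].
  move/fsubsetP: sub; apply; move/fsubsetP: sZ1; apply.
  by rewrite raddfB; apply: mem_diffset; apply: fB.
Qed.

(** Each [u] in [A] gets a chosen [D u] with [2u - D u] in [W] and a chosen [H u] with [f u - H u]
    in [W]. If [a] and [b] take the same shifts all along, these cancel in differences:
    [D^i a - D^i b = 2^i (a - b)], and on this difference [H^s] acts as [f^s]. *)
Lemma long_doubling_chain A W J e :
  (sumset A A `<=` sumset A W)%fset ->
  (forall x, x \in A -> f x \in sumset A W) ->
  #|` W| ^ (J * e.+1) < #|` A| ->
  exists2 v, v != 0%R & forall i s, i < J -> s <= e ->
    iter s f (v *+ 2 ^ i)%R \in diffset A A.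
Proof.
move=> /fsubsetP hD hH hc.
have eD u : exists p : V * V, (u \in A) ==>
    [&& p.1 \in A, p.2 \in W & (u + u == p.1 + p.2)%R].
  have [uA|_] := boolP (u \in A); last by exists (0%R, 0%R).
  have /sumsetP [a [w [aA wW e1]]] := hD _ (mem_sumset uA uA).
  by exists (a, w); rewrite /= aA wW e1 eqxx.
have eH u : exists p : V * V, (u \in A) ==>
    [&& p.1 \in A, p.2 \in W & (f u == p.1 + p.2)%R].
  have [uA|_] := boolP (u \in A); last by exists (0%R, 0%R).
  have /sumsetP [a [w [aA wW e1]]] := hH _ uA.
  by exists (a, w); rewrite /= aA wW e1 eqxx.
pose D u := (xchoose (eD u)).1; pose dD u := (xchoose (eD u)).2.
pose H u := (xchoose (eH u)).1; pose dH u := (xchoose (eH u)).2.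
have DP u : u \in A -> [/\ D u \in A, dD u \in W & (u + u = D u + dD u)%R].
  by move=> uA; have /implyP/(_ uA)/and3P [? ? /eqP] := xchooseP (eD u).
have HP u : u \in A -> [/\ H u \in A, dH u \in W & (f u = H u + dH u)%R].
  by move=> uA; have /implyP/(_ uA)/and3P [? ? /eqP] := xchooseP (eH u).
have DA i u : u \in A -> iter i D u \in A.
  by elim: i => [//|i IH] uA /=; case: (DP _ (IH uA)).
have HA i u : u \in A -> iter i H u \in A.
  by elim: i => [//|i IH] uA /=; case: (HP _ (IH uA)).
(* Digit [i * (e + 1) + s] is the shift of the doubling step at [D^i u] if [s = 0], and otherwise
   that of the [s]-th application of [H] after [D^i]. *)
pose delta q u := if q %% e.+1 is s.+1 then dH (iter s H (iter (q %/ e.+1) D u))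
                  else dD (iter (q %/ e.+1) D u).
have [|a [b [aA bA ab hd]]] := pigeonhole_digits _ hc (delta := delta).
  move=> q u _ uA; rewrite /delta; case: (q %% e.+1) => [|s].
    by case: (DP _ (DA (q %/ e.+1) _ uA)).
  by case: (HP _ (HA s _ (DA (q %/ e.+1) _ uA))).
have hq i s : i < J -> s <= e -> i * e.+1 + s < J * e.+1 by nia.
have dDe i : i < J -> dD (iter i D a) = dD (iter i D b).
  move=> iJ; have := hd (i * e.+1 + 0) (hq _ _ iJ (leq0n _)).
  by rewrite /delta addn0 modnMl mulnK.
have dHe i s : i < J -> s < e -> dH (iter s H (iter i D a)) = dH (iter s H (iter i D b)).
  move=> iJ sJ; have := hd (i * e.+1 + s.+1) (hq _ _ iJ sJ).
  by rewrite /delta modnMDl divnMDl // modn_small ?ltnS // divn_small ?ltnS // addn0.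
have subE (x y z t p q : V) : (x = y + p -> z = t + q -> p = q -> x - z = y - t)%R.
  by move=> -> -> ->; rewrite opprD addrACA subrr addr0.
have step2 i : i <= J -> (iter i D a - iter i D b = (a - b) *+ 2 ^ i)%R.
  elim: i => [_|i IH iJ] /=; first by rewrite expn0 mulr1n.
  have [_ _ h1] := DP _ (DA i _ aA); have [_ _ h2] := DP _ (DA i _ bA).
  rewrite -(subE _ _ _ _ _ _ h1 h2 (dDe _ iJ)) opprD addrACA IH ?(ltnW iJ) //.
  by rewrite -mulrnDr addnn -mul2n -expnS.
have stepf i s : i < J -> s <= e ->
    (iter s H (iter i D a) - iter s H (iter i D b) = iter s f ((a - b) *+ 2 ^ i))%R.
  move=> iJ; elim: s => [_|s IH se] /=; first by rewrite step2 // ltnW.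
  have [_ _ h1] := HP _ (HA s _ (DA i _ aA)); have [_ _ h2] := HP _ (HA s _ (DA i _ bA)).
  by rewrite -(subE _ _ _ _ _ _ h1 h2 (dHe _ _ iJ se)) -raddfB IH // ltnW.
exists (a - b)%R; first by rewrite subr_eq0.
move=> i s iJ se; rewrite -stepf //; apply: mem_diffset; exact/HA/DA.
Qed.

(** Binary expansion of the multiplier; [0] in [B] stands for the absent bits. *)
Lemma apset_sub_nsumset (w : V) B J :
  0%R \in B -> (forall i, i < J -> (w *+ 2 ^ i)%R \in B) ->
  (apset (2 ^ J) w `<=` nsumset J B)%fset.
Proof.
move=> B0 hB; apply/fsubsetP => x /apsetP [c cN ->]; elim: J c cN hB => [|J IH] c cN hB /=.
  by move: cN; rewrite expn0 ltnS leqn0 => /eqP ->; rewrite mulr0n in_fset1.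
have hB' i : i < J -> (w *+ 2 ^ i)%R \in B by move=> iJ; apply: hB; apply: ltnW.
have [cJ|cJ] := ltnP c (2 ^ J).
  by rewrite -[(w *+ c)%R]add0r; apply: mem_sumset => //; apply: IH.
rewrite -(subnKC cJ) mulrnDr; apply: mem_sumset; first exact: hB.
by apply: IH => //; move: cN; rewrite expnS; lia.
Qed.

Lemma card_apset_le (w : V) N : #|` apset N w| <= N.
Proof.
apply: leq_trans (leq_imfset_card _ _ _) _.
by rewrite /= undup_id ?iota_uniq // size_iota.
Qed.

(** An element of the [m]-fold sumset is a combination of elements of [W] with coefficients at most
    [m]. For bounded [|W|] this is polynomial in [m], whereas [|W|^m] would swamp the gain from
    progressions of length [2^J]. *)
Lemma card_nsumset_le W m : #|` nsumset m W| <= m.+1 ^ #|` W|.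
Proof.
pose comb m := foldr (fun w => sumset (apset m.+1 w)) [fset 0%R]%fset : seq V -> {fset V}.
have comb_card (s : seq V) : #|` comb m s| <= m.+1 ^ size s.
  elim: s => [|w s IH] /=; first by rewrite cardfs1.
  apply: leq_trans (card_sumset_le _ _) _; rewrite expnS.
  by apply: leq_mul => //; exact: card_apset_le.
have comb0 p (s : seq V) : 0%R \in comb p s.
  elim: s => [|w s IH] /=; first by rewrite in_fset1.
  rewrite -[0%R]addr0; apply: mem_sumset => //.
  by apply/apsetP; exists 0; rewrite ?mulr0n.
have combS p (s : seq V) x : x \in comb p s -> x \in comb p.+1 s.
  elim: s x => [|w s IH] x //= /sumsetP [u [y [/apsetP [c cp ->] ys ->]]].
  apply: mem_sumset; last exact: IH.
  by apply/apsetP; exists c => //; apply: leqW.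
have combD p (s : seq V) w x : w \in s -> x \in comb p s -> (w + x)%R \in comb p.+1 s.
  elim: s x => [|w' s IH] x //=; rewrite inE => ws /sumsetP [u [y [/apsetP [c cp ->] ys ->]]].
  have [->|ne] := eqVneq w w'.
    rewrite addrA; apply: mem_sumset; last exact: combS.
    by apply/apsetP; exists c.+1 => //; rewrite mulrS.
  rewrite addrCA; apply: mem_sumset.
    by apply/apsetP; exists c => //; apply: leqW.
  by apply: IH => //; move: ws; rewrite (negbTE ne).
apply: leq_trans (comb_card W); apply: fsubset_leq_card; apply/fsubsetP.
elim: m {comb_card} => [|p IH] x /=.
  by rewrite in_fset1 => /eqP ->; apply: comb0.
by move=> /sumsetP [w [y [wW /IH yc ->]]]; apply: combD.
Qed.

Lemma sumset_nsumset_cover A W J :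
  (sumset A A `<=` sumset A W)%fset ->
  (sumset A (nsumset J (sumset A A)) `<=` sumset A (nsumset (J.*2) W))%fset.
Proof.
move=> hA; elim: J => [|J IH]; first exact: fsubset_refl.
rewrite doubleS /=.
have h1 : (sumset A (sumset A A) `<=` sumset A (sumset W W))%fset.
  rewrite !sumsetA; apply: (@fsubset_trans _ (sumset (sumset A W) A)).
    by apply: sumsetS => //; exact: fsubset_refl.
  rewrite -sumsetA [sumset W A]sumsetC sumsetA; apply: sumsetS => //; exact: fsubset_refl.
rewrite sumsetA; apply: (@fsubset_trans _ (sumset (sumset A (sumset W W)) (nsumset J (sumset A A)))).
  by apply: sumsetS => //; exact: fsubset_refl.
rewrite -sumsetA [sumset (sumset W W) _]sumsetC sumsetA.
apply: (@fsubset_trans _ (sumset (sumset A (nsumset J.*2 W)) (sumset W W))).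
  by apply: sumsetS => //; exact: fsubset_refl.
by rewrite -sumsetA [sumset _ (sumset W W)]sumsetC -(sumsetA W W); exact: fsubset_refl.
Qed.

(** A progression of length [2^J] in direction [f^s v] lies in [J (A' + A')] with [A' = A - A], and
    its summands are absorbed into [A'] at the price of elements of [W]. So adding it multiplies the
    size only by a polynomial in [J]. *)
Lemma structure A kappa J e : A != fset0 ->
  #|` sumset A [fset f x | x in A]%fset| <= kappa * #|` A| ->
  (kappa ^ 5 + kappa ^ 4) ^ (J * e.+1) < #|` A| ->
  exists2 v, v != 0%R & forall s, s <= e ->
    #|` sumset (sumset A [fset f x | x in A]%fset) (apset (2 ^ J) (iter s f v))| <=
      kappa ^ 2 * #|` A| * (J.*2.+3) ^ (kappa ^ 5 + kappa ^ 4).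
Proof.
move=> A0 hT hJ.
have [cD [W [cW hD hH]]] := doubling_cover A0 hT.
set A' := diffset A A in cD hD hH.
have /fset0Pn [a0 a0A] := A0.
have cAA' : #|` A| <= #|` A'|.
  apply: (@card_le_inj _ _ (fun a => a - a0)%R); first by move=> x y _ _; apply: addIr.
  by move=> x xA; apply: mem_diffset.
have [|v v0 hv] := @long_doubling_chain A' W J e hD hH.
  apply: leq_trans cAA'; apply: leq_ltn_trans hJ; case: (posnP (J * e.+1)) => [->//|h].
  by rewrite leq_exp2r.
exists v => // s se.
have A'0 : 0%R \in A' by rewrite -(subrr a0); apply: mem_diffset.
have A'N x : x \in A' -> (- x)%R \in A'.
  by move=> /diffsetP [a [b [aA bA ->]]]; rewrite opprB; apply: mem_diffset.
have iterMn n x : iter s f (x *+ n)%R = (iter s f x *+ n)%R.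
  by elim: {se} s => //= s ->; rewrite raddfMn.
have hap : (apset (2 ^ J) (iter s f v) `<=` nsumset J (sumset A' A'))%fset.
  apply: apset_sub_nsumset.
    by rewrite -[0%R]addr0; apply: mem_sumset.
  move=> i iJ; rewrite -iterMn.
  have /diffsetP [x [y [xA yA ->]]] := hv i s iJ se.
  by apply: mem_sumset => //; apply: A'N.
(* Subtracting [c] turns [a + f b] into [(a - a0) + f (b - a0)], which lies in [A' + W + W]. *)
pose c := (a0 + f a0)%R.
apply: (@leq_trans #|` sumset A' (nsumset J.*2.+2 W)|).
  apply: (@card_le_inj _ _ (fun x => x - c)%R); first by move=> x y _ _; apply: addIr.
  move=> x /sumsetP [? [w [/sumsetP [a [? [aA /imfsetP [b /= bA ->] ->]]] wap ->]]].
  have fb : f (b - a0)%R \in sumset A' W by apply: hH; apply: mem_diffset.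
  have aa : (a - a0)%R \in A' by apply: mem_diffset.
  have -> : (a + f b + w - c = (a - a0) + (f (b - a0) + w))%R.
    by rewrite raddfB /c opprD [RHS]addrA [in RHS]addrACA addrAC.
  have h1 : ((a - a0) + f (b - a0))%R \in sumset A' (sumset W W).
    have /sumsetP [x1 [w1 [x1A w1W ->]]] := fb.
    rewrite addrA sumsetA; apply: mem_sumset => //.
    by move/fsubsetP: hD; apply; apply: mem_sumset.
  have h2 : (a - a0 + (f (b - a0) + w))%R \in
      sumset (sumset A' (nsumset J (sumset A' A'))) (sumset W W).
    rewrite addrA [sumset (sumset _ _) _]sumsetC sumsetA [sumset (sumset W W) _]sumsetC.
    by apply: mem_sumset => //; move/fsubsetP: hap; apply.
  have /fsubsetP h3 := sumset_nsumset_cover J hD.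
  have /sumsetP [p [q [hp hq ->]]] := h2.
  rewrite /= (sumsetA W) [sumset _ (nsumset _ _)]sumsetC (sumsetA A').
  by apply: mem_sumset => //; apply: h3.
apply: leq_trans (card_sumset_le _ _) _; apply: leq_mul => //.
apply: leq_trans (card_nsumset_le _ _) _; apply: leq_pexp2l => //.
Qed.

End Structure.

(** * A discrete Brunn-Minkowski inequality *)

Lemma fset_argmin (R : realDomainType) (T : choiceType) (f : T -> R) (A : {fset T}) :
  A != fset0 -> exists2 x, x \in A & forall y, y \in A -> f x <= f y.
Proof.
elim/fset1U_rect: A => [|a A aA IH]; first by rewrite eqxx.
move=> _; have [->|/IH [x xA hx]] := eqVneq (A : {fset T}) fset0.
  by exists a; rewrite ?fsetU0 ?in_fset1 // => y; rewrite in_fset1 => /eqP ->.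
have [h|h] := leP (f a) (f x).
  exists a; first by rewrite !inE eqxx.
  move=> y; rewrite !inE => /orP [/eqP -> //|yA]; apply: le_trans h _; exact: hx.
exists x; first by rewrite !inE xA orbT.
by move=> y; rewrite !inE => /orP [/eqP -> |yA]; [exact: ltW | exact: hx].
Qed.

Lemma fset_argmax (R : realDomainType) (T : choiceType) (f : T -> R) (A : {fset T}) :
  A != fset0 -> exists2 x, x \in A & forall y, y \in A -> f y <= f x.
Proof.
move=> /(fset_argmin (fun x => - f x)) [x xA hx]; exists x => // y /hx.
by rewrite lerN2.
Qed.

Lemma card_sumset_rat (X Y : {fset rat}) : X != fset0 -> Y != fset0 ->
  (#|` X| + #|` Y| <= #|` sumset X Y| + 1)%N.
Proof.
move=> /(fset_argmax id) [x1 x1X hx] /(fset_argmin id) [y0 y0Y hy].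
pose E1 := [fset (x + y0)%R | x in X]%fset; pose E2 := [fset (x1 + y)%R | y in Y]%fset.
have c1 : #|` E1| = #|` X| by apply: card_imfset => x y /addIr.
have c2 : #|` E2| = #|` Y| by apply: card_imfset => x y /addrI.
rewrite -c1 -c2 -cardfsUI; apply: leq_add.
  apply: fsubset_leq_card; rewrite fsubUset; apply/andP; split; apply/fsubsetP => z.
    by move=> /imfsetP [x /= xX ->]; apply: mem_sumset.
  by move=> /imfsetP [x /= xX ->]; apply: mem_sumset.
rewrite -(cardfs1 (x1 + y0)); apply: fsubset_leq_card; apply/fsubsetP => z.
rewrite in_fsetI in_fset1 => /andP [/imfsetP [x /= xX ->] /imfsetP [y /= yY e]].
have := hx _ xX; have := hy _ yY; move=> /= h1 h2.
by apply/eqP; congr (_ + _); lra.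
Qed.

(** Integration over level sets: at each height up to [h] the superlevel sets of [al] and [be] are
    nonempty, their sumset lies in that of [si], and the [-1] of [card_sumset_rat] integrates to
    [-h]. The induction peels off one layer: the least value [m] is subtracted everywhere and a
    point attaining it is deleted. *)
Lemma level_set_sum (R : realFieldType) (X Y : {fset rat}) (al be si : rat -> R) (h : R) :
  (forall x, x \in X -> 0 <= al x <= h) -> (exists2 x, x \in X & al x = h) ->
  (forall y, y \in Y -> 0 <= be y <= h) -> (exists2 y, y \in Y & be y = h) ->
  (forall x y, x \in X -> y \in Y -> Num.min (al x) (be y) <= si (x + y)) ->
  \sum_(x <- X) al x + \sum_(y <- Y) be y - h <= \sum_(t <- sumset X Y) si t.
Proof.
move: {2}(#|` X| + #|` Y|)%N (leqnn (#|` X| + #|` Y|)) => n.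
elim: n X Y al be si h => [|n IH] X Y al be si h hn.
  move=> _ [x xX _]; move: hn; rewrite leqn0 addn_eq0 cardfs_eq0 => /andP [/eqP X0].
  by move: xX; rewrite X0.
wlog : X Y al be hn / exists2 x, x \in X & (forall x', x' \in X -> al x <= al x') /\
    (forall y, y \in Y -> al x <= be y).
  move=> W hX eX hY eY hs.
  have X0 : X != fset0 by case: eX => x xX _; apply/fset0Pn; exists x.
  have Y0 : Y != fset0 by case: eY => x xX _; apply/fset0Pn; exists x.
  have [x xX mx] := fset_argmin al X0; have [y yY my] := fset_argmin be Y0.
  have [hxy|/ltW hxy] := leP (al x) (be y).
    apply: W => //; exists x => //; split=> // y' y'Y; apply: le_trans hxy _; exact: my.
  rewrite [X in X - h]addrC sumsetC; apply: W => //; first by rewrite addnC.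
    exists y => //; split=> // x' x'X; apply: le_trans hxy _; exact: mx.
  by move=> y' x' y'Y x'X; rewrite addrC minC; apply: hs.
move=> [x0 x0X [mX mY]] hX eX hY eY hs.
have X0 : X != fset0 by apply/fset0Pn; exists x0.
have Y0 : Y != fset0 by case: eY => y yY _; apply/fset0Pn; exists y.
set m := al x0 in mX mY.
have m0 : 0 <= m by case/andP: (hX _ x0X).
have mh : m <= h by case/andP: (hX _ x0X).
have sge t : t \in sumset X Y -> m <= si t.
  move=> /sumsetP [x [y [xX yY ->]]]; apply: le_trans (hs _ _ xX yY).
  by rewrite le_min mX // mY.
have card1 := card_sumset_rat X0 Y0.
have card1R : (#|` X|)%:R + (#|` Y|)%:R <= (#|` sumset X Y|)%:R + 1 :> R.
  by rewrite -natrD natr1 ler_nat -addn1.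
have sumc (T : choiceType) (B : {fset T}) (c : R) : \sum_(x <- B) c = c * (#|` B|)%:R.
  by rewrite big_const_seq count_predT iter_addr_0 mulr_natr.
have sumB (T : choiceType) (B : {fset T}) (F : T -> R) :
    \sum_(x <- B) F x = \sum_(x <- B) (F x - m) + m * (#|` B|)%:R.
  by rewrite big_split /= sumrN sumc subrK.
rewrite (sumB _ X) (sumB _ Y) (sumB _ (sumset X Y)).
(* If [m = h], then [al] and [be] are constant and one layer is everything; otherwise deleting [x0]
   keeps a point of value [h]. *)
have [mh'|mh'] := eqVneq m h.
  have -> : \sum_(x <- X) (al x - m) = 0.
    rewrite big_seq big1 // => x xX; apply/eqP; rewrite subr_eq0 eq_le mX //.
    by rewrite mh'; case/andP: (hX _ xX) => _ ->.
  have -> : \sum_(x <- Y) (be x - m) = 0.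
    rewrite big_seq big1 // => x xX; apply/eqP; rewrite subr_eq0 eq_le mY //.
    by rewrite mh'; case/andP: (hY _ xX) => _ ->.
  have : 0 <= \sum_(t <- sumset X Y) (si t - m).
    by rewrite big_seq; apply: sumr_ge0 => t tS; rewrite subr_ge0 sge.
  by rewrite -mh'; nra.
have {}mh' : m < h by rewrite lt_neqAle mh' mh.
pose X1 := (X `\ x0)%fset.
have cX1 : (#|` X1| + #|` Y| <= n)%N by move: hn; rewrite (cardfsD1 x0) x0X /X1; lia.
have sX1 x : x \in X1 -> x \in X by rewrite in_fsetD1 => /andP [].
have := IH X1 Y (fun x => al x - m) (fun y => be y - m) (fun t => si t - m) (h - m) cX1.
have xsum : \sum_(x <- X) (al x - m) = \sum_(x <- X1) (al x - m).
  by rewrite (big_fsetD1 x0) //= subrr add0r.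
have ssum : \sum_(t <- sumset X1 Y) (si t - m) <= \sum_(t <- sumset X Y) (si t - m).
  have sub : (sumset X1 Y `<=` sumset X Y)%fset.
    by apply: sumsetS; [apply/fsubsetP => x; exact: sX1 | exact: fsubset_refl].
  rewrite [X in _ <= X](big_fsetID _ (mem (sumset X1 Y))) /=.
  rewrite (_ : [fset x | x in sumset X Y & x \in sumset X1 Y]%fset = sumset X1 Y); last first.
    apply/fsetP => t; rewrite !inE /=; apply/andP/idP => [[]//|ht]; split=> //.
    by move/fsubsetP: sub; apply.
  rewrite lerDl big_seq; apply: sumr_ge0 => t; rewrite !inE /= => /andP [tS _].
  by rewrite subr_ge0 sge.
rewrite xsum => H.
have {}H : \sum_(x <- X1) (al x - m) + \sum_(y <- Y) (be y - m) - (h - m) <=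
   \sum_(t <- sumset X1 Y) (si t - m).
  apply: H.
  - move=> x /sX1 xX; rewrite subr_ge0 mX // lerD2r; by case/andP: (hX _ xX).
  - case: eX => x xX ex; exists x; last by rewrite ex.
    by rewrite in_fsetD1 xX andbT; apply/eqP => e; move: mh'; rewrite /m -ex e ltxx.
  - move=> y yY; rewrite subr_ge0 mY // lerD2r; by case/andP: (hY _ yY).
  - by case: eY => y yY ey; exists y; rewrite ?ey.
  - move=> x y /sX1 xX yY; have := hs _ _ xX yY; rewrite !ge_min.
    by rewrite !lerD2r.
nra.
Qed.

Lemma real_root (R : realType) (n : nat) (a : R) : 0 <= a ->
  exists2 p, 0 <= p & p ^+ n.+1 = a.
Proof.
move=> a0; exists (a `^ (n.+1%:R^-1)); first exact: powR_ge0.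
by rewrite -powR_mulrn ?powR_ge0 // -powRrM mulVf ?pnatr_eq0 // powRr1.
Qed.

(** In the induction step the defect is [l m (u^n - v^n) (u - v)], whose last two factors have the
    same sign. *)
Lemma power_mean2 (R : realFieldType) (n : nat) (l m u v : R) :
  0 <= l -> 0 <= m -> l + m = 1 -> 0 <= u -> 0 <= v ->
  (l * u + m * v) ^+ n <= l * u ^+ n + m * v ^+ n.
Proof.
move=> l0 m0 lm u0 v0; elim: n => [|n IH]; first by rewrite !expr0 !mulr1 lm.
have w0 : 0 <= l * u + m * v by rewrite addr_ge0 // mulr_ge0.
rewrite exprSr; apply: le_trans (ler_wpM2r w0 IH) _.
have mono : 0 <= (u ^+ n - v ^+ n) * (u - v).
  have [h|/ltW h] := leP u v.
    by apply: mulr_le0; rewrite subr_le0 // lerXn2r.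
  by apply: mulr_ge0; rewrite subr_ge0 // lerXn2r.
rewrite !exprSr -subr_ge0.
have -> : l * (u ^+ n * u) + m * (v ^+ n * v) -
   (l * u ^+ n + m * v ^+ n) * (l * u + m * v) =
   l * m * ((u ^+ n - v ^+ n) * (u - v)) +
   (1 - (l + m)) * (l * (u ^+ n * u) + m * (v ^+ n * v)) by ring.
by rewrite lm subrr mul0r addr0 mulr_ge0 // mulr_ge0.
Qed.

Definition slice (d : nat) (S : {fset 'rV[rat]_(1 + d)}) (t : rat) : {fset 'rV[rat]_d} :=
  [fset rsubmx x | x in [fset x in S | x ord0 ord0 == t]]%fset.

Definition shadow (d : nat) (S : {fset 'rV[rat]_(1 + d)}) : {fset 'rV[rat]_d} :=
  [fset rsubmx x | x in S]%fset.

Definition heads (d : nat) (S : {fset 'rV[rat]_(1 + d)}) : {fset rat} :=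
  [fset (x : 'rV[rat]_(1 + d)) ord0 ord0 | x in S]%fset.

(* The sum of the cardinalities of the [2 ^ d] coordinate projections of [S]; for a down-set
   it is [#|S + {0,1}^d|]. *)
Fixpoint proj_sum (d : nat) : {fset 'rV[rat]_d} -> nat :=
  if d is d'.+1 then fun S : {fset 'rV[rat]_(1 + d')} =>
    (\sum_(t <- heads S) proj_sum (slice S t) + proj_sum (shadow S))%N
  else fun S => #|` S|.

Lemma row_head_tail (d : nat) (x y : 'rV[rat]_(1 + d)) :
  x ord0 ord0 = y ord0 ord0 -> rsubmx x = rsubmx y -> x = y.
Proof.
move=> h t; rewrite -(hsubmxK x) -(hsubmxK y) t; congr row_mx.
apply/rowP => i; rewrite !mxE [i]ord1.
have -> : lshift d 0 = ord0 :> 'I_(1 + d) by apply/val_inj.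
exact: h.
Qed.

Lemma sliceP d (S : {fset 'rV[rat]_(1 + d)}) t u :
  reflect (exists x, [/\ x \in S, x ord0 ord0 = t & u = rsubmx x]) (u \in slice S t).
Proof.
apply: (iffP idP) => [/imfsetP [x /=]|[x [xS xt ->]]].
  by rewrite !inE /= => /andP [xS /eqP xt] ->; exists x.
by apply/imfsetP; exists x => //=; rewrite !inE /= xS xt eqxx.
Qed.

Lemma card_slices d (S : {fset 'rV[rat]_(1 + d)}) :
  #|` S| = (\sum_(t <- heads S) #|` slice S t|)%N.
Proof.
rewrite card_fset_sum1 (partition_big_imfset _ (fun x : 'rV[rat]_(1 + d) => x ord0 ord0)) /=.
apply: eq_bigr => t _; rewrite /slice card_in_imfset /=; last first.
  move=> x y; rewrite !inE => /andP [_ /eqP xt] /andP [_ /eqP yt] e.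
  by apply: row_head_tail => //; rewrite xt yt.
by rewrite -[RHS]/(#|` [fset x in S | x ord0 ord0 == t]|%fset) card_fset_sum1 big_fset.
Qed.

Lemma mem_slice d (S : {fset 'rV[rat]_(1 + d)}) x :
  x \in S -> rsubmx x \in slice S (x ord0 ord0).
Proof. by move=> xS; apply/sliceP; exists x. Qed.

Lemma mem_heads d (S : {fset 'rV[rat]_(1 + d)}) x : x \in S -> x ord0 ord0 \in heads S.
Proof. by move=> xS; apply/imfsetP; exists x. Qed.

Lemma mem_shadow d (S : {fset 'rV[rat]_(1 + d)}) x : x \in S -> rsubmx x \in shadow S.
Proof. by move=> xS; apply/imfsetP; exists x. Qed.

Lemma slice_neq0 d (S : {fset 'rV[rat]_(1 + d)}) t :
  t \in heads S -> slice S t != fset0.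
Proof.
move=> /imfsetP [x /= xS ->]; apply/fset0Pn; exists (rsubmx x); exact: mem_slice.
Qed.

Lemma leq_sum_fset (T : choiceType) (A B : {fset T}) (F : T -> nat) :
  (A `<=` B)%fset -> (\sum_(x <- A) F x <= \sum_(x <- B) F x)%N.
Proof.
move=> /fsubsetP sub; rewrite [X in (_ <= X)%N](big_fsetID _ (mem A)) /=.
rewrite (_ : [fset x | x in B & x \in A]%fset = A); first exact: leq_addr.
by apply/fsetP => t; rewrite !inE /=; apply/andP/idP => [[]//|h]; split=> //; apply: sub.
Qed.

Lemma sliceS d (S S' : {fset 'rV[rat]_(1 + d)}) t :
  (S `<=` S')%fset -> (slice S t `<=` slice S' t)%fset.
Proof.
move=> /fsubsetP sub; apply/fsubsetP => u /sliceP [x [xS <- ->]].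
by apply: mem_slice; apply: sub.
Qed.

Lemma headsS d (S S' : {fset 'rV[rat]_(1 + d)}) :
  (S `<=` S')%fset -> (heads S `<=` heads S')%fset.
Proof.
move=> /fsubsetP sub; apply/fsubsetP => u /imfsetP [x /= xS ->].
by apply: mem_heads; apply: sub.
Qed.

Lemma shadowS d (S S' : {fset 'rV[rat]_(1 + d)}) :
  (S `<=` S')%fset -> (shadow S `<=` shadow S')%fset.
Proof.
move=> /fsubsetP sub; apply/fsubsetP => u /imfsetP [x /= xS ->].
by apply: mem_shadow; apply: sub.
Qed.

Lemma proj_sumS d (S S' : {fset 'rV[rat]_d}) :
  (S `<=` S')%fset -> (proj_sum S <= proj_sum S')%N.
Proof.
elim: d S S' => [|d IH] S S' sub /=; first exact: fsubset_leq_card.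
apply: leq_add; last by apply: IH; exact: (@shadowS d).
apply: leq_trans (leq_sum_fset _ (@headsS d _ _ sub)).
by apply: leq_sum => t _; apply: IH; exact: (@sliceS d).
Qed.

Lemma proj_sum_le d (S : {fset 'rV[rat]_d}) : (proj_sum S <= 2 ^ d * #|` S|)%N.
Proof.
elim: d S => [|d IH] S /=; first by rewrite mul1n.
rewrite expnS -mulnA mul2n -addnn; apply: leq_add.
  rewrite (@card_slices d S) big_distrr /=; by apply: leq_sum => t _; apply: IH.
apply: leq_trans (IH _) _; rewrite leq_mul2l; apply/orP; right.
exact: leq_imfset_card.
Qed.

(** A projection forgetting coordinate [i] has at most as many points as there are lines in
    direction [i] meeting [S], and each such line has at least [N] points of the thickened set. In
    the recursion the shadow accounts for the first coordinate, the slices for the others. *)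
Lemma proj_sum_thick d (S : {fset 'rV[rat]_d}) N : (0 < N)%N ->
  (N * proj_sum S <= N * #|` S| +
     2 ^ d * \sum_(i < d) #|` sumset S (apset N (delta_mx ord0 i))|)%N.
Proof.
move=> N0; elim: d S => [|d IH] S /=; first exact: leq_addr.
rewrite big_ord_recl mulnDr addnC.
have lift_shift (i : 'I_d) : lift ord0 i = rshift 1 i :> 'I_(1 + d) by apply: val_inj.
apply: (@leq_trans (2 ^ d.+1 * #|` sumset S (apset N (delta_mx ord0 ord0))| + (N * #|` S| +
   2 ^ d.+1 * (\sum_(i < d) #|` sumset S (apset N (delta_mx ord0 (lift ord0 i)))|)))%N); last by rewrite [X in (_ <= _ + X)%N]mulnDr addnCA.
apply: leq_add.
- apply: (@leq_trans (N * (2 ^ d * #|` @shadow d S|))%N).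
    by rewrite leq_mul2l proj_sum_le orbT.
  apply: (@leq_trans (2 ^ d * #|` sumset S (apset N (delta_mx ord0 ord0))|)%N); last first.
    by rewrite leq_mul2r leq_exp2l // leqnSn orbT.
  rewrite mulnCA leq_mul2l; apply/orP; right; rewrite mulnC.
  pose I := [fset c in iota 0 N]%fset.
  have -> : N = #|` I| by rewrite card_fseq undup_id ?iota_uniq // size_iota.
  have ex (u : 'rV[rat]_d) : exists x : 'rV[rat]_(1 + d), (u \in @shadow d S) ==> (x \in S) && (rsubmx x == u).
    have [/imfsetP [x /= xS ->]|_] := boolP (u \in @shadow d S); last by exists 0.
    by exists x; rewrite xS eqxx.
  pose r u := xchoose (ex u).
  have rP u : u \in @shadow d S -> r u \in S /\ rsubmx (r u) = u.
    by move=> uS; have /implyP/(_ uS)/andP [? /eqP] := xchooseP (ex u).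
  apply: (@card_ge_prod _ _ _ (fun (u : 'rV[rat]_d) (c : nat) =>
      r u + (delta_mx ord0 ord0 : 'rV[rat]_(1 + d)) *+ c)).
    move=> u c /rP [uS _]; rewrite inE /= mem_iota add0n => /andP [_ cN].
    by apply: mem_sumset => //; apply/apsetP; exists c => //; move: cN; rewrite card_fseq undup_id ?iota_uniq // size_iota.
  have tl (u : 'rV[rat]_d) c : rsubmx (r u + (delta_mx ord0 ord0 : 'rV[rat]_(1 + d)) *+ c) = rsubmx (r u).
    apply/rowP => i; rewrite !mxE mulmxnE !mxE.
    by rewrite -lift_shift eqxx /= mul0rn addr0.
  move=> u c u' c' uS _ uS' _ e.
  have eu : u = u'.
    by have [_ <-] := rP _ uS; have [_ <-] := rP _ uS'; rewrite -(tl u c) e tl.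
  split=> //; move: e; rewrite eu => /addrI /(congr1 (fun m : 'rV[rat]_(1 + d) => m ord0 ord0)).
  by rewrite !mulmxnE !mxE !eqxx /= => /eqP; rewrite eqr_nat => /eqP.
- rewrite (@card_slices d S) [X in (X <= _)%N]big_distrr /=.
  apply: (@leq_trans (\sum_(t <- @heads d S) (N * #|` @slice d S t| +
      2 ^ d * \sum_(i < d) #|` sumset (@slice d S t) (apset N (delta_mx ord0 i))|))%N).
    by apply: leq_sum => t _; apply: IH.
  rewrite big_split /= -!big_distrr /=; apply: leq_add => //.
  apply: (@leq_trans (2 ^ d * \sum_(i < d) #|` sumset S (apset N (delta_mx ord0 (lift ord0 i)))|)%N); last first.
    by rewrite leq_mul2r leq_exp2l // leqnSn orbT.
  rewrite leq_mul2l; apply/orP; right; rewrite exchange_big /=; apply: leq_sum => i _.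
  rewrite (@card_slices d (sumset S _)).
  have hs : (@heads d S `<=` @heads d (sumset S (apset N (delta_mx ord0 (lift ord0 i)))))%fset.
    apply: (@headsS d); apply/fsubsetP => x xS; rewrite -[x]addr0; apply: mem_sumset => //.
    by apply/apsetP; exists 0%N; rewrite ?mulr0n.
  apply: leq_trans (leq_sum_fset _ hs); apply: leq_sum => t _.
  apply: fsubset_leq_card; apply/fsubsetP => u /sumsetP [? [? [/sliceP [x [xS xt ->]] /apsetP [c cN ->] ->]]].
  apply/sliceP; exists (x + (delta_mx ord0 (lift ord0 i) : 'rV[rat]_(1 + d)) *+ c); split.
  + by apply: mem_sumset => //; apply/apsetP; exists c.
  + by rewrite mxE mulmxnE mxE eqxx /= mul0rn addr0.
  + apply/rowP => k; rewrite !mxE !mulmxnE !mxE !eqxx /=; congr (_ + _ *+ _); congr (_%:R).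
Qed.

Lemma sumset_slice d (X Y : {fset 'rV[rat]_(1 + d)}) x y :
  (sumset (slice X x) (slice Y y) `<=` slice (sumset X Y) (x + y))%fset.
Proof.
apply/fsubsetP => u /sumsetP [? [? [/sliceP [p [pX <- ->]] /sliceP [q [qY <- ->]] ->]]].
apply/sliceP; exists (p + q); split; first exact: mem_sumset.
  by rewrite mxE.
by apply/rowP => i; rewrite !mxE.
Qed.

Lemma sumset_slice_shadow d (X Y : {fset 'rV[rat]_(1 + d)}) x y :
  (sumset (slice X x) (slice Y y) `<=` shadow (sumset X Y))%fset.
Proof.
apply/fsubsetP => u /sumsetP [? [? [/sliceP [p [pX _ ->]] /sliceP [q [qY _ ->]] ->]]].
apply/imfsetP; exists (p + q); first exact: mem_sumset.
by apply/rowP => i; rewrite !mxE.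
Qed.

Lemma sumset_heads d (X Y : {fset 'rV[rat]_(1 + d)}) :
  (sumset (heads X) (heads Y) `<=` heads (sumset X Y))%fset.
Proof.
apply/fsubsetP => u /sumsetP [? [? [/imfsetP [p /= pX ->] /imfsetP [q /= qY ->] ->]]].
by apply/imfsetP; exists (p + q); rewrite ?mxE //; apply: mem_sumset.
Qed.

(** Induction on the dimension through slices, normalised by the largest slices [a] of [X] and [b]
    of [Y]. The [-1] left by [level_set_sum] is made up by the shadow of [X + Y], which contains the
    sum of the two largest slices; this is why projections are counted along with points. *)
Lemma brunn_minkowski (R : realType) d (X Y : {fset 'rV[rat]_d.+1}) (x y : R) :
  X != fset0 -> Y != fset0 -> 0 <= x -> 0 <= y ->
  x ^+ d.+1 <= (#|` X|)%:R -> y ^+ d.+1 <= (#|` Y|)%:R ->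
  (x + y) ^+ d.+1 <= (proj_sum (sumset X Y))%:R.
Proof.
elim: d X Y x y => [|d IH] X Y x y X0 Y0 x0 y0 hx hy.
  have cardh (S : {fset 'rV[rat]_(1 + 0)}) : #|` heads S| = #|` S|.
    apply: card_in_imfset => /= u v _ _ e; apply: row_head_tail => //.
    by rewrite [rsubmx u]thinmx0 [rsubmx v]thinmx0.
  have neh (S : {fset 'rV[rat]_(1 + 0)}) : S != fset0 -> heads S != fset0.
    by rewrite -!cardfs_gt0 cardh.
  have h1 := card_sumset_rat (neh X X0) (neh Y Y0).
  have h2 := fsubset_leq_card (@sumset_heads 0 X Y).
  rewrite !cardh in h1 h2.
  (* The nonempty shadow supplies the [1] missing in [card_sumset_rat]. *)
  have h3 : (0 < #|` @shadow 0 (sumset X Y)|)%N.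
    rewrite cardfs_gt0; have /fset0Pn [u uX] := X0; have /fset0Pn [v vY] := Y0.
    by apply/fset0Pn; exists (rsubmx (u + v : 'rV_(1 + 0))); apply: mem_shadow; apply: mem_sumset.
  rewrite !expr1 in hx hy *.
  apply: (@le_trans _ _ ((#|` X| + #|` Y|)%N%:R)); first by rewrite natrD lerD.
  rewrite ler_nat /= -(@card_slices 0 (sumset X Y)).
  by apply: leq_trans h1 _; apply: leq_add; [exact: h2 | exact: h3].
have neh (S : {fset 'rV[rat]_(1 + d.+1)}) : S != fset0 -> heads S != fset0.
  by move=> /fset0Pn [u uS]; apply/fset0Pn; exists (u ord0 ord0); apply: mem_heads.
have [xm xmX hxm] := fset_argmax (fun t => (#|` @slice d.+1 X t|)%:R : R) (neh X X0).
have [ym ymY hym] := fset_argmax (fun t => (#|` @slice d.+1 Y t|)%:R : R) (neh Y Y0).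
set a : R := _%:R in hxm; set b : R := _%:R in hym.
have a0 : 0 < a by rewrite ltr0n cardfs_gt0; apply: slice_neq0.
have b0 : 0 < b by rewrite ltr0n cardfs_gt0; apply: slice_neq0.
have [p p0 ep] := real_root d (ltW a0); have [q q0 eq] := real_root d (ltW b0).
have pgt0 : 0 < p by rewrite lt0r p0 andbT; apply: contraTneq a0 => e; rewrite -ep e expr0n ltxx.
have qgt0 : 0 < q by rewrite lt0r q0 andbT; apply: contraTneq b0 => e; rewrite -eq e expr0n ltxx.
have pq0 : 0 < p + q by rewrite addr_gt0.
pose c := (p + q) ^+ d.+1.
have c0 : 0 < c by rewrite exprn_gt0.
have level := @level_set_sum R (@heads d.+1 X) (@heads d.+1 Y)
  (fun t => (#|` @slice d.+1 X t|)%:R / a) (fun t => (#|` @slice d.+1 Y t|)%:R / b)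
  (fun t => (proj_sum (@slice d.+1 (sumset X Y) t))%:R / c) 1.
have {}level : (#|` X|)%:R / a + (#|` Y|)%:R / b - 1 <=
    (\sum_(t <- sumset (@heads d.+1 X) (@heads d.+1 Y)) proj_sum (@slice d.+1 (sumset X Y) t))%N%:R / c.
  rewrite (@card_slices d.+1 X) (@card_slices d.+1 Y) !natr_sum !mulr_suml.
  apply: level.
  - by move=> t tX; rewrite divr_ge0 ?(ltW a0) //= ler_pdivrMr // mul1r hxm.
  - by exists xm => //; rewrite divff // gt_eqF.
  - by move=> t tX; rewrite divr_ge0 ?(ltW b0) //= ler_pdivrMr // mul1r hym.
  - by exists ym => //; rewrite divff // gt_eqF.
  - move=> s t sX tY.
    (* The two slices have at least [mu a = (r p)^(d+1)] and [mu b = (r q)^(d+1)] points, so the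
       inductive bound for their sumset is [(r (p + q))^(d+1) = mu c]. *)
    set mu := Num.min _ _.
    have mu0 : 0 <= mu by rewrite le_min !divr_ge0 // ltW.
    have [r r0 er] := real_root d mu0.
    have hmx : mu <= (#|` @slice d.+1 X s|)%:R / a by rewrite ge_min lexx.
    have hmy : mu <= (#|` @slice d.+1 Y t|)%:R / b by rewrite ge_min lexx orbT.
    rewrite ler_pdivlMr // in hmx; rewrite ler_pdivlMr // in hmy.
    rewrite ler_pdivlMr // /c -er -exprMn mulrDr.
    apply: (@le_trans _ _ (proj_sum (sumset (@slice d.+1 X s) (@slice d.+1 Y t)))%:R).
      apply: IH; rewrite ?mulr_ge0 //; try exact: slice_neq0.
        by rewrite exprMn er ep.
      by rewrite exprMn er eq.
    by rewrite ler_nat; apply: proj_sumS; apply: sumset_slice.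
have hsh : c <= (proj_sum (@shadow d.+1 (sumset X Y)))%:R.
  apply: (@le_trans _ _ (proj_sum (sumset (@slice d.+1 X xm) (@slice d.+1 Y ym)))%:R).
    by apply: IH; rewrite ?ep ?eq //; exact: slice_neq0.
  by rewrite ler_nat; apply: proj_sumS; apply: sumset_slice_shadow.
have hs := leq_sum_fset (fun t => proj_sum (@slice d.+1 (sumset X Y) t)) (@sumset_heads d.+1 X Y).
have main : c * ((#|` X|)%:R / a + (#|` Y|)%:R / b) <= (proj_sum (sumset X Y))%:R.
  rewrite /= natrD; move: level; rewrite ler_pdivlMr // => level.
  have : (\sum_(t <- sumset (@heads d.+1 X) (@heads d.+1 Y)) proj_sum (@slice d.+1 (sumset X Y) t))%N%:R
     <= (\sum_(t <- @heads d.+1 (sumset X Y)) proj_sum (@slice d.+1 (sumset X Y) t))%N%:R :> R.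
    by rewrite ler_nat.
  move=> /(le_trans level) h; set u := _ / a + _ / b.
  have -> : c * u = (u - 1) * c + c by ring.
  by apply: lerD; [exact: h | exact: hsh].
apply: le_trans main.
(* Weights proportional to [p] and [q], at the points [x / p] and [y / q], give the mean
   [(x + y) / (p + q)]. *)
have := @power_mean2 R d.+2 (p / (p + q)) (q / (p + q)) (x / p) (y / q).
rewrite !divr_ge0 ?(ltW pq0) // -mulrDl divff ?gt_eqF // => /(_ isT isT erefl isT isT).
have -> : p / (p + q) * (x / p) + q / (p + q) * (y / q) = (x + y) / (p + q).
  by field; rewrite !gt_eqF.
rewrite expr_div_n ler_pdivrMr ?exprn_gt0 // => h; apply: le_trans h _.
have -> : (p / (p + q) * (x / p) ^+ d.+2 + q / (p + q) * (y / q) ^+ d.+2) * (p + q) ^+ d.+2 =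
   c * (x ^+ d.+2 / a + y ^+ d.+2 / b).
  rewrite /c -ep -eq !expr_div_n !(exprS _ d.+1); field.
  by rewrite !expf_neq0 ?gt_eqF // gt_eqF.
apply: ler_wpM2l; first exact: ltW.
by apply: lerD; apply: ler_wpM2r; rewrite ?invr_ge0 // ltW.
Qed.

(** * Lattices and coprimality *)

Section RatMx.
Variables m n p : nat.
Implicit Types (A : 'M[int]_(m, n)).

Lemma ratmxE A i j : ratmx A i j = (A i j)%:~R.
Proof. by rewrite mxE. Qed.

Lemma ratmxM A (B : 'M[int]_(n, p)) : ratmx (A *m B) = ratmx A *m ratmx B.
Proof. exact: (map_mxM (intmul (1 : rat))). Qed.

Lemma ratmxD A B : ratmx (A + B) = ratmx A + ratmx B.
Proof. exact: (map_mxD (intmul (1 : rat))). Qed.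

Lemma ratmxB A B : ratmx (A - B) = ratmx A - ratmx B.
Proof. exact: (map_mxB (intmul (1 : rat))). Qed.

Lemma ratmx_tr A : ratmx A^T = (ratmx A)^T.
Proof. by apply/matrixP => i j; rewrite !mxE. Qed.

Lemma ratmx_inj : injective (@ratmx m n).
Proof.
move=> A B /matrixP e; apply/matrixP => i j; have := e i j.
by rewrite !ratmxE => /intr_inj.
Qed.

End RatMx.

Lemma det_ratmx n (A : 'M[int]_n) : \det (ratmx A) = (\det A)%:~R.
Proof. exact: (det_map_mx (intmul (1 : rat))). Qed.

Lemma unit_ratmx n (A : 'M[int]_n) : (ratmx A \in unitmx) = (\det A != 0).
Proof. by rewrite unitmxE det_ratmx unitfE intr_eq0. Qed.

Definition in_lattice (N d : nat) (B : 'M[int]_(N, d)) (x : 'rV[rat]_d) : Prop :=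
  exists y : 'rV[int]_N, x = ratmx (y *m B).

(** The clauses say that [B] and [Q] span the same row lattice. In Smith form [B = L D R] the matrix
    [D] is its top square block [E] padded with zero rows, so [Q = E R] serves. *)
Lemma lattice_basis N d (B : 'M[int]_(N, d)) : \rank (ratmx B) = d ->
  exists Q : 'M[int]_d, exists X : 'M[int]_(N, d), exists Y : 'M[int]_(d, N),
    [/\ B = X *m Q, Q = Y *m B & \det Q != 0].
Proof.
move=> rk; have dN : (d <= N)%N by rewrite -rk rank_leq_row.
have [L uL [R uR [s _ eB]]] := int_Smith_normal_form B.
set D := \matrix_(i, j) _ in eB.
pose E : 'M[int]_d := \matrix_(i, j) (s`_i *+ (i == j :> nat)).
have eD : D = pid_mx d *m E.
  apply/matrixP => i j; rewrite !mxE.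
  rewrite (bigD1 j) //= big1 ?addr0.
    rewrite !mxE eqxx mulr1n; have [e|] := eqVneq (i : nat) (j : nat).
      by rewrite e ltn_ord mul1r.
    by rewrite mul0r.
  move=> k /negbTE kj; rewrite !mxE.
  by rewrite (_ : (k == j :> nat) = false) ?mulr0n ?mulr0 // -kj.
have eE : E = pid_mx d *m D.
  rewrite eD mulmxA pid_mx_id // .
  by rewrite pid_mx_1 mul1mx.
exists (E *m R), (L *m pid_mx d), (pid_mx d *m invmx L).
have e1 : B = L *m pid_mx d *m (E *m R) by rewrite eB eD !mulmxA.
have e2 : E *m R = pid_mx d *m invmx L *m B.
  by rewrite eB !mulmxA -(mulmxA _ (invmx L)) mulVmx // mulmx1 -eE.
split=> //.
rewrite -unit_ratmx -row_free_unit -row_leq_rank -{1}rk.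
by rewrite {1}e1 ratmxM mxrankM_maxr.
Qed.

(** In Smith form the index is the product of the [|s_i|], and the box [0 <= k_i < |s_i|] represents
    distinct cosets. *)
Lemma lattice_cosets d (C : 'M[int]_d) : \det C != 0 ->
  exists z : 'I_`|\det C|%N -> 'rV[int]_d,
    forall p q (y : 'rV[int]_d), z p - z q = y *m C -> p = q.
Proof.
move=> C0; have [L uL [R uR [s _ eC]]] := int_Smith_normal_form C.
set D := \matrix_(i, j) _ in eC.
have eD : D = diag_mx (\row_i s`_i).
  by apply/matrixP => i j; rewrite !mxE.
have absu (M : 'M[int]_d) : M \in unitmx -> `|\det M|%N = 1%N.
  move=> uM; have := det1 int d; rewrite -(mulmxV uM) det_mulmx => /(congr1 absz).
  by rewrite abszM /= => /eqP; rewrite muln_eq1 => /andP [/eqP].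
have absprod (F : 'I_d -> int) : absz (\prod_i F i)%R = (\prod_i absz (F i))%N.
  by apply: (big_morph absz) => [x y|//]; rewrite abszM.
pose T := {dffun forall i : 'I_d, 'I_(absz (s`_i)%R)}.
have cT : #|{: T}| = `|\det C|%N.
  rewrite eC !det_mulmx eD det_diag !abszM (absu L uL) (absu R uR) mul1n muln1.
  rewrite card_dep_ffun foldrE big_map absprod big_enum /=.
  by apply: eq_bigr => i _; rewrite card_ord mxE.
pose k (t : T) : 'rV[int]_d := \row_i (t i : nat)%:Z.
exists (fun p => k (enum_val (cast_ord (esym cT) p)) *m R) => p q y e.
apply: (can_inj (cast_ordKV cT)); apply: enum_val_inj.
move: (enum_val _) (enum_val _) e => u t; rewrite -mulmxBl => e.
have {}e : k t - k u = y *m L *m D.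
  by rewrite -[LHS](mulmxK uR) e eC !mulmxA mulmxK.
apply/ffunP => i; apply/val_inj => /=.
have := congr1 (fun M : 'rV_d => M 0 i) e; rewrite eD mul_mx_diag !mxE.
set a := \sum_j _; case: (t i) (u i) => [a1 h1] [a2 h2] /= ee.
have : (s`_i %| a1%:Z - a2%:Z)%Z by rewrite ee dvdz_mull.
rewrite dvdzE => dv.
have hlt : (absz (a1%:Z - a2%:Z)%R < absz (s`_i)%R)%N by move: h1 h2; lia.
have : absz (a1%:Z - a2%:Z)%R = 0%N.
  by apply/eqP; apply: contraLR hlt; rewrite -leqNgt -lt0n => h; apply: dvdn_leq.
lia.
Qed.

Definition dilate (d : nat) (L1 L2 : 'M[int]_d) : 'M[rat]_d :=
  (ratmx L2)^T *m invmx (ratmx L1)^T.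

(* Coprimality applied to the lattice [Gamma] spanned by [B]: the index of [L1 Gamma] in
   [L1 Gamma + L2 Gamma] is at least [|det L1|]. *)
Lemma coprime_index d N (L1 L2 : 'M[int]_d) (B : 'M[int]_(N, d)) :
  coprime_mats [:: L1; L2] -> \det L1 != 0 -> \rank (ratmx B) = d ->
  exists2 ga : 'I_`|\det L1|%N -> 'rV[rat]_d,
    forall p, in_lattice B (ga p) &
    forall p q, in_lattice B ((ga p - ga q) *m dilate L1 L2) -> p = q.
Proof.
move=> cop L10 rkB.
have [Q [X [Y [eB eQ Q0]]]] := lattice_basis rkB.
have uL1 : (ratmx L1)^T \in unitmx by rewrite unitmx_tr unit_ratmx.
have uQ : ratmx Q \in unitmx by rewrite unit_ratmx.
(* The rows of [G] span [L1 Gamma + L2 Gamma], of which [P0] will be a basis; [C1] and [C2] express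
   [L1] and [L2] in the bases [Q] and [P0]. *)
pose G := col_mx (Q *m L1^T) (Q *m L2^T).
have rkG : \rank (ratmx G) = d.
  apply/eqP; rewrite eqn_leq rank_leq_col /=.
  have -> : ratmx G = col_mx (ratmx (Q *m L1^T)) (ratmx (Q *m L2^T)).
    exact: map_col_mx.
  have uG : ratmx (Q *m L1^T) \in unitmx by rewrite ratmxM ratmx_tr unitmx_mul uQ uL1.
  rewrite -{1}(mxrank_unit uG); apply: mxrankS; rewrite -addsmxE; exact: addsmxSl.
have [P0 [X' [Y' [eG eP P00]]]] := lattice_basis rkG.
have uP : ratmx P0 \in unitmx by rewrite unit_ratmx.
pose C1 := usubmx X'; pose C2 := dsubmx X'; pose Y1 := lsubmx Y'; pose Y2 := rsubmx Y'.
have [e1 e2] : Q *m L1^T = C1 *m P0 /\ Q *m L2^T = C2 *m P0.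
  move: eG; rewrite -[X' in X' *m P0]vsubmxK mul_col_mx => /eq_col_mx [-> ->]; by [].
have P0I (M M' : 'M[int]_d) : M *m P0 = M' *m P0 -> M = M'.
  move=> /(congr1 (@ratmx _ _)); rewrite !ratmxM => e; apply: ratmx_inj.
  by rewrite -[LHS](mulmxK uP) e mulmxK.
have P0Ir (M M' : 'rV[int]_d) : M *m P0 = M' *m P0 -> M = M'.
  move=> /(congr1 (@ratmx _ _)); rewrite !ratmxM => e; apply: ratmx_inj.
  by rewrite -[LHS](mulmxK uP) e mulmxK.
have bez : Y1 *m C1 + Y2 *m C2 = 1%:M.
  apply: P0I; rewrite mul1mx {2}eP mulmxDl -!mulmxA -e1 -e2.
  by rewrite -[Y' in RHS]hsubmxK mul_row_col.
(* If [L1 Gamma + L2 Gamma] had larger covolume than [Gamma], these two bases would keep both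
   matrices integral with a determinant factor below [1], which coprimality forbids. *)
have detle : `|\det (ratmx P0)| <= `|\det (ratmx Q)|.
  rewrite leNgt; apply/negP => lt; apply: cop.
  exists (invmx (ratmx P0))^T, (ratmx Q)^T.
  have dp : 0 < `|\det (ratmx P0)| by rewrite normr_gt0 -unitfE -unitmxE.
  split; rewrite ?unitmx_tr ?unitmx_inv //.
  - by rewrite normr_gt0 mulf_neq0 // !det_tr -unitfE -unitmxE ?unitmx_inv.
  - by rewrite !det_tr det_inv normrM normfV mulrC ltr_pdivrMr // mul1r.
  - have key (L C : 'M[int]_d) : Q *m L^T = C *m P0 ->
        (invmx (ratmx P0))^T *m ratmx L *m (ratmx Q)^T = ratmx C^T.
      move=> e; rewrite ratmx_tr -[ratmx C](mulmxK uP) -ratmxM -e ratmxM ratmx_tr.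
      by rewrite !trmx_mul trmxK mulmxA.
    by move=> L; rewrite !inE => /orP [/eqP ->|/eqP ->]; [exists C1^T | exists C2^T]; apply: key.
have detC : (`|\det L1| <= `|\det C1|)%N.
  have := congr1 (fun M => `|\det M|%N) e1; rewrite !det_mulmx det_tr !abszM => e.
  have : (`|\det P0| <= `|\det Q|)%N.
    by move: detle; rewrite !det_ratmx -!intr_norm ler_int -!abszE.
  have : (0 < `|\det P0|)%N by rewrite absz_gt0.
  by move=> P0gt0 PQ; rewrite -(leq_pmul2r P0gt0) -e mulnC leq_mul2r PQ orbT.
have C10 : \det C1 != 0.
  by rewrite -absz_gt0; apply: leq_trans detC; rewrite absz_gt0.
have [z hz] := lattice_cosets C10.
(* Here the [z_p] are distinct modulo the lattice of [C1]. As [Y1 C1 + Y2 C2 = 1], multiplying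
   [z_p Y2] by [C2] recovers [z_p] modulo that lattice. *)
exists (fun p => ratmx (z (widen_ord detC p) *m Y2 *m Q)).
  by move=> p; exists (z (widen_ord detC p) *m Y2 *m Y); rewrite -!mulmxA -eQ.
move=> p q [w ew].
have [] : widen_ord detC p = widen_ord detC q; last by move=> /val_inj.
set zp := z _ in ew; set zq := z _ in ew.
pose y := (zp - zq) *m Y2.
have ey : ratmx (zp *m Y2 *m Q) - ratmx (zq *m Y2 *m Q) = ratmx (y *m Q).
  by rewrite -ratmxB -!mulmxBl.
rewrite ey eB mulmxA in ew.
have {}ew : y *m C2 = w *m X *m C1.
  apply: P0Ir; rewrite -!mulmxA -e1 -e2; apply: ratmx_inj; rewrite !mulmxA.
  rewrite (ratmxM (y *m Q)) (ratmxM (w *m X *m Q)) -ew /dilate !ratmx_tr !mulmxA.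
  by rewrite mulmxKV.
apply: (hz _ _ ((zp - zq) *m Y1 + w *m X)).
by rewrite mulmxDl -ew -[LHS]mulmx1 -bez mulmxDr !mulmxA.
Qed.

(** * Thin directions of sets with small sumset *)

Definition no_invariant_subspace (d : nat) (g : 'M[rat]_d) : Prop :=
  forall U : 'M[rat]_d, (0 < \rank U)%N -> (\rank U < d)%N -> ~ (U *m g <= U)%MS.

(** By Cayley-Hamilton the span of [v, v g, ..., v g^d] is invariant under [g], and it is not
    zero. *)
Lemma cyclic_basis (d : nat) (g : 'M[rat]_d.+1) (v : 'rV[rat]_d.+1) :
  no_invariant_subspace g -> v != 0 -> \matrix_(s < d.+1) iter s (mulmxr g) v \in unitmx.
Proof.
move=> irr v0; set W := \matrix_(s < _) _.
have it s : iter s (mulmxr g) v = v *m g ^+ s.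
  elim: s => [|s IH] /=; first by rewrite expr0 mulmx1.
  by rewrite IH exprSr mulmxA.
have mem s : (s < d.+1)%N -> (v *m g ^+ s <= W)%MS.
  by move=> h; rewrite -it; have := row_sub (Ordinal h) W; rewrite rowK.
have memd : (v *m g ^+ d.+1 <= W)%MS.
  have := Cayley_Hamilton g; rewrite -[char_poly g]coefK poly_def size_char_poly.
  rewrite big_ord_recr /= linearD linear_sum /= linearZ /= rmorphXn /= horner_mx_X.
  have -> : (char_poly g)`_d.+1 = 1.
    by have /monicP := char_poly_monic g; rewrite lead_coefE size_char_poly.
  rewrite scale1r => /eqP; rewrite addrC addr_eq0 => /eqP ->.
  rewrite mulmxN eqmx_opp mulmx_sumr; apply: summx_sub => i _.
  rewrite linearZ /= rmorphXn /= horner_mx_X -scalemxAr; apply: scalemx_sub.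
  exact: mem.
have inv : (W *m g <= W)%MS.
  apply/row_subP => s; rewrite row_mul rowK it -mulmxA.
  rewrite -[g ^+ s *m g]/(g ^+ s * g) -exprSr.
  have := ltn_ord s; rewrite leq_eqVlt => /orP [/eqP ->//|]; exact: mem.
have rk0 : (0 < \rank W)%N.
  rewrite lt0n mxrank_eq0; apply: contra v0 => /eqP W0.
  by have := mem 0%N isT; rewrite expr0 mulmx1 W0 submx0.
rewrite -row_free_unit -row_leq_rank leqNgt; apply/negP => h.
exact: (irr W rk0 h inv).
Qed.

(** The base [3/2] is below [2]: against a progression of length [2^J] a factor [(4/3)^J] remains,
    which is a power of [|A|] when [J] is of order [log |A|]. *)
Lemma poly_le_exp (R : realType) (k : nat) :
  exists2 C : R, 0 < C & forall J, ((J.*2.+3)%:R : R) ^+ k.+1 <= C * (3 / 2) ^+ J.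
Proof.
have [r r0 er] : exists2 r : R, 0 <= r & r ^+ k.+1 = 3 / 2 by apply: real_root; lra.
have r1 : 1 < r.
  by rewrite -(@ltr_pXn2r _ k.+1) ?nnegrE // er expr1n; lra.
pose c := 3 + 2 / (r - 1).
have c0 : 0 < 2 / (r - 1) by rewrite divr_gt0 // subr_gt0.
have bern J : 1 + J%:R * (r - 1) <= r ^+ J.
  elim: J => [|J IH]; first by rewrite mul0r addr0 expr0.
  rewrite exprSr; apply: le_trans (ler_wpM2r r0 IH).
  have J0 : 0 <= J%:R :> R by []. 
  have := mulr_ge0 J0 (sqr_ge0 (r - 1)); rewrite -natr1; lra.
have key J : (J.*2.+3)%:R <= c * r ^+ J.
  have -> : (J.*2.+3)%:R = 2 * J%:R + 3 :> R by rewrite -addn3 natrD -muln2 natrM mulrC.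
  apply: le_trans (ler_wpM2l _ (bern J)); last by rewrite /c; lra.
  have J0 : 0 <= J%:R :> R by [].
  have -> : c * (1 + J%:R * (r - 1)) = 3 + 2 / (r - 1) + 3 * (J%:R * (r - 1)) + 2 * J%:R.
    by rewrite /c; field; rewrite subr_eq0 gt_eqF.
  have : 0 <= J%:R * (r - 1) by rewrite mulr_ge0 // subr_ge0 ltW.
  lra.
have cc0 : 0 < c by rewrite /c; lra.
exists (c ^+ k.+1); first exact: exprn_gt0.
move=> J; rewrite -er -exprM mulnC exprM -exprMn lerXn2r ?nnegrE //.
by rewrite mulr_ge0 ?(ltW cc0) // exprn_ge0.
Qed.

(** [structure] with the largest admissible [J] and [N = 2^J]. Divided by [N], the bound says that
    the sumset lies on at most [C0 |A|^(1 - s0)] lines in each of the independent directions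
    [v g^s]. *)
Lemma smooth_directions (R : realType) (d kappa : nat) : (0 < kappa)%N ->
  exists C0 s0 : R, [/\ 0 < C0, 0 < s0, s0 < 1 &
   forall (g : 'M[rat]_d.+1) (A : {fset 'rV[rat]_d.+1}),
     g \in unitmx -> no_invariant_subspace g -> (1 < #|` A|)%N ->
     (#|` sumset A [fset mulmxr g x | x in A]%fset| <= kappa * #|` A|)%N ->
     exists N, exists2 W : 'M[rat]_d.+1, (0 < N)%N /\ W \in unitmx &
       forall i, (#|` sumset (sumset A [fset mulmxr g x | x in A]%fset) (apset N (row i W))|)%:R
          <= N%:R * (C0 * (#|` A|)%:R `^ (1 - s0)) :> R ].
Proof.
move=> k0; pose k := (kappa ^ 5 + kappa ^ 4)%N.
have k2 : (2 <= k)%N by rewrite /k -[2%N]/(1 + 1)%N; apply: leq_add; rewrite expn_gt0 k0.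
have [C1 C10 hC1] := poly_le_exp R k.-1.
rewrite prednK in hC1; last exact: ltnW.
pose q := (k ^ d.+2)%N.
have q2 : (2 <= q)%N by rewrite /q expnS; apply: (leq_trans k2); rewrite leq_pmulr // expn_gt0 (ltnW k2).
have q2R : 2 <= q%:R :> R by rewrite ler_nat.
(* This makes [q^s0 = 4/3], so [|A| <= q^(J+1)] gives [|A|^s0 <= (4/3)^(J+1)]; the factor [4/3] in
   the constant pays for the [+1]. *)
pose s0 : R := ln (4 / 3) / ln q%:R.
have lnq : 0 < ln q%:R :> R by rewrite ln_gt0 //; lra.
have ln43 : 0 < ln (4 / 3) :> R by rewrite ln_gt0 //; lra.
exists ((kappa ^ 2)%:R * C1 * (4 / 3)), s0; split.
- by rewrite !mulr_gt0 ?ltr0n ?expn_gt0 ?k0 //; lra.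
- by rewrite divr_gt0.
- by rewrite ltr_pdivrMr // mul1r ltr_ln ?posrE; lra.
move=> g A ug irr A1 hT.
have A0 : A != fset0 by rewrite -cardfs_gt0; exact: ltnW.
(* The predecessor makes the lower bound strict: [q^J < |A| <= q^(J+1)]. *)
pose J := trunc_log q (#|` A|).-1.
have hJ1 : (q ^ J < #|` A|)%N.
  have := @trunc_logP q (#|` A|).-1 q2.
  by rewrite -/J; move: A1; lia.
have hJ2 : (#|` A| <= q ^ J.+1)%N.
  by have := trunc_log_ltn (#|` A|).-1 q2; rewrite -/J; move: A1; lia.
have ginj : injective (mulmxr g : 'rV_d.+1 -> 'rV_d.+1).
  by move=> x y /= e; rewrite -[x](mulmxK ug) e mulmxK.
have [|v v0 hv] := @structure _ (mulmxr g) ginj A kappa J d.+1 A0 hT.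
  by rewrite mulnC expnM.
exists (2 ^ J)%N, (\matrix_(s < d.+1) iter s (mulmxr g) v).
  by split; [rewrite expn_gt0 | exact: cyclic_basis].
move=> i; rewrite rowK.
have := hv i (ltnW (ltn_ord i)); rewrite -(ler_nat R) => h; apply: le_trans h _.
rewrite !natrM !natrX; set n : R := (#|` A|)%:R.
have n0 : 0 < n by rewrite ltr0n ltnW.
have nn : n `^ (1 - s0) = n * (n `^ s0)^-1.
  rewrite powRD; last by rewrite (gt_eqF n0) implybT.
  by rewrite powRr1 ?powRN // ltW.
have ns : n `^ s0 <= (4 / 3) ^+ J.+1.
  apply: (@le_trans _ _ ((q%:R ^+ J.+1) `^ s0)).
    apply: ge0_ler_powR; rewrite ?nnegrE ?(ltW n0) ?exprn_ge0 //.
      by rewrite ltW // divr_gt0.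
    by rewrite -natrX ler_nat.
  rewrite -powR_mulrn // -powRrM mulrC powRrM powR_mulrn ?powR_ge0 //.
  rewrite (_ : q%:R `^ s0 = 4 / 3) // /powR gt_eqF ?ltr0n ?(ltnW q2) //.
  by rewrite /s0 divfK ?gt_eqF // lnK // posrE; lra.
have ns0 : 0 < n `^ s0 by rewrite powR_gt0.
rewrite nn.
have h1 := hC1 J.
have p32 : 0 < (3 / 2 : R) ^+ J by apply: exprn_gt0; lra.
have e2 : (2 : R) ^+ J = (4 / 3) ^+ J * (3 / 2) ^+ J.
  by rewrite -exprMn; congr (_ ^+ _); field.
have eR : 2 ^+ J * (kappa%:R ^+ 2 * C1 * (4 / 3) * (n * (n `^ s0)^-1)) =
    (kappa%:R ^+ 2 * n * (C1 * (3 / 2) ^+ J)) * (4 / 3) ^+ J.+1 / n `^ s0.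
  have alg (a c u w m p : R) : p != 0 ->
      (u * w) * (a * c * (4 / 3) * (m * p^-1)) = a * m * (c * w) * (4 / 3 * u) / p.
    by move=> p0; field.
  by rewrite e2 (exprS _ J); apply: alg; rewrite gt_eqF.
rewrite eR ler_pdivlMr //.
apply: ler_pM => //.
- by rewrite !mulr_ge0 ?exprn_ge0 // ltW.
- exact: ltW.
- apply: ler_wpM2l => //; by rewrite !mulr_ge0 ?exprn_ge0 // ltW.
Qed.

(** * Classes of near-counterexamples *)

Lemma powR_le_affine (R : realType) (s t : R) : 0 < s -> s < 1 -> 0 <= t ->
  t `^ (1 - s) <= (1 - s) * t + s.
Proof.
move=> s0 s1; rewrite le_eqVlt => /orP [/eqP <-|t0].
  by rewrite mulr0 add0r powR0 ?(ltW s0) // subr_eq0 gt_eqF.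
pose u := (1 - s) * t + s.
have u0 : 0 < u by rewrite /u; have : 0 < (1 - s) * t by [apply: mulr_gt0 => //; lra]; lra.
rewrite /powR gt_eqF // -/u -[leRHS](@lnK _ u) ?posrE // ler_expR.
have lnle (x : R) : 0 < x -> ln x <= x - 1.
  move=> x0; have := expR_ge1Dx (ln x); rewrite lnK ?posrE //; lra.
have h1 := lnle _ (divr_gt0 t0 u0).
have h2 := lnle _ (divr_gt0 ltr01 u0).
rewrite ln_div ?posrE // in h1; rewrite ln_div ?posrE // ln1 in h2.
have e : (1 - s) * (t / u) + s * (1 / u) = 1.
  by rewrite !mulrA -mulrDl mulr1 divff ?gt_eqF.
nra.
Qed.

(** The tangent line of [t^(1-s)] at [t = 1], rescaled. Pieces of sizes [c + r = n] thus have error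
    terms adding up to at most [1 + s] times that of the whole, so splitting is cheap for small
    [s]. *)
Lemma powR_frac_le (R : realType) (s c n : R) : 0 < s -> s < 1 -> 0 <= c -> 0 < n ->
  c `^ (1 - s) <= ((1 - s) * (c / n) + s) * n `^ (1 - s).
Proof.
move=> s0 s1 c0 n0.
have n0' : n != 0 by rewrite gt_eqF.
have cn : 0 <= c / n by rewrite divr_ge0 // ltW.
rewrite -[in leLHS](divfK n0' c) powRM //; last exact: ltW.
apply: ler_wpM2r; first exact: powR_ge0.
exact: powR_le_affine.
Qed.

Lemma powR_frac_ge (R : realType) (s c n : R) : 0 < s -> s < 1 -> 0 < c -> c <= n ->
  c / n * n `^ (1 - s) <= c `^ (1 - s).
Proof.
move=> s0 s1 c0 cn; have n0 : 0 < n by apply: lt_le_trans cn.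
have n0' : n != 0 by rewrite gt_eqF.
have cn0 : 0 <= c / n by rewrite divr_ge0 // ltW.
rewrite -[in leRHS](divfK n0' c) powRM //; last exact: ltW.
apply: ler_wpM2r; first exact: powR_ge0.
by apply: ger1_powR; [rewrite divr_gt0 //= ler_pdivrMr // mul1r | lra].
Qed.

(* Here [n], [c], [r] stand for the sizes of [A], of a class [C] of [A], and of the rest;
   [tA], [tC], [tR] for the sizes of their sumsets and [u] for the part of the sumset of [A]
   lost when [C] is removed. *)
Lemma class_arith (R : realType) (K D s e n c r u tA tR tC : R) :
  1 <= K -> 0 < D -> 0 < s -> s < 1 -> 0 <= e -> 4 * K * (s + e) <= 1 ->
  n = c + r -> 0 <= r -> 0 < c -> n <= u -> u + tR <= tA -> tC <= u -> 0 <= tA ->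
  tA < K * n - (1 - e) * (D * n `^ (1 - s)) ->
  K * r - D * r `^ (1 - s) <= tR ->
  [/\ n <= 2 * K * c,
      tC < K * c - (1 - 2 * K * (s + e)) * (D * c `^ (1 - s)),
      K * c - D * c `^ (1 - s) <= tC -> u - tC < 2 * K * (s + e) * n &
      u + D * n `^ (1 - s) / (4 * K) < K * c].
Proof.
move=> K1 D0 s0 s1 e0 hse en r0 c0 nu uR Cu tA0 near goodR.
have n0 : 0 < n by lra.
have cn : c <= n by lra.
have fc := powR_frac_le s0 s1 (ltW c0) n0.
have fr := powR_frac_le s0 s1 r0 n0.
have fg := powR_frac_ge s0 s1 c0 cn.
have hn0 : 0 < n `^ (1 - s) by apply: powR_gt0.
have hrn : r `^ (1 - s) <= n `^ (1 - s).
  by apply: ge0_ler_powR; rewrite ?nnegrE //; lra.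
set hn := n `^ (1 - s) in fc fr fg hn0 hrn near *.
set hc := c `^ (1 - s) in fc fg *.
set hr := r `^ (1 - s) in fr hrn goodR *.
have sumfrac : c / n + r / n = 1 by rewrite -mulrDl -en divff // gt_eqF.
have hcr : D * hc + D * hr <= (1 + s) * (D * hn).
  rewrite -mulrDr mulrCA; apply: ler_wpM2l; first exact: ltW.
  have := lerD fc fr; rewrite -mulrDl.
  rewrite (_ : (1 - s) * (c / n) + s + ((1 - s) * (r / n) + s) = (1 - s) * (c / n + r / n) + 2 * s); last by ring.
  by rewrite sumfrac (_ : (1 - s) * 1 + 2 * s = 1 + s) //; ring.
have hrn' : D * hr <= D * hn by rewrite ler_pM2l.
have hn0' : 0 < D * hn by apply: mulr_gt0.
have se4 : s + e <= 1 / 4.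
  have : (K - 1) * (s + e) >= 0 by apply: mulr_ge0; lra.
  lra.
have hnn : D * hn <= 2 * K * n.
  have : (1 / 2) * (D * hn) <= (1 - e) * (D * hn) by apply: ler_wpM2r; lra.
  lra.
have en1 : e * (D * hn) <= (1 / 2) * n.
  have h1 : e * (D * hn) <= e * (2 * K * n) by apply: ler_wpM2l.
  have h2 : 4 * K * e * n <= 1 * n by apply: ler_wpM2r; [lra | have : 0 <= K * s by [apply: mulr_ge0; lra]; lra].
  lra.
(* Removing the class loses [u >= n] sums, whereas the bounds for [A] and for the rest leave room
   for at most [K c + n / 2]. *)
have i1 : n <= 2 * K * c.
  have : u < K * c + e * (D * hn) by rewrite en in near *; lra.
  lra.
have ur : u < K * c - ((1 - e) * (D * hn) - D * hr) by rewrite en in near *; lra.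
have hcge : D * hn <= 2 * K * (D * hc).
  have h1 : D * (c / n * hn) <= D * hc by rewrite ler_pM2l.
  have h2 : 1 <= 2 * K * (c / n) by rewrite mulrA ler_pdivlMr // mul1r.
  have h3 : 1 * (D * hn) <= 2 * K * (c / n) * (D * hn) by apply: ler_wpM2r; lra.
  have h4 : 2 * K * (D * (c / n * hn)) <= 2 * K * (D * hc) by apply: ler_wpM2l => //; lra.
  have -> : D * hn = 1 * (D * hn) by ring.
  apply: le_trans h3 _; apply: le_trans h4.
  by rewrite le_eqVlt; apply/orP; left; apply/eqP; ring.
have hse' : (s + e) * (D * hn) <= (s + e) * (2 * K * (D * hc)) by apply: ler_wpM2l => //; lra.
split=> //.
- lra.
- move=> goodC.
  have : (s + e) * (D * hn) <= (s + e) * (2 * K * n) by apply: ler_wpM2l => //; lra.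
  lra.
- have K4 : 0 < 4 * K by lra.
  have h1 : D * hn / (4 * K) <= (1 - e) * (D * hn) - D * hr; last by lra.
  rewrite ler_pdivrMr //.
  have h2 : (4 * K * (s + e)) * (D * hn) <= 1 * (D * hn) by apply: ler_wpM2r; lra.
  have h3 : (D * hn) * 2 <= (1 - e) * (D * hn) * (4 * K) - D * hr * (4 * K) + 1 * (D * hn).
    have h4 : 4 * K * (D * hc + D * hr) <= 4 * K * ((1 + s) * (D * hn)) by apply: ler_wpM2l => //; lra.
    lra.
  lra.
Qed.

Definition tsum (d : nat) (g : 'M[rat]_d) (X Y : {fset 'rV[rat]_d}) : {fset 'rV[rat]_d} :=
  sumset X [fset mulmxr g y | y in Y]%fset.

Section Classes.
Variables (d : nat) (g : 'M[rat]_d).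
Hypothesis ug : g \in unitmx.
Implicit Types (X Y A C : {fset 'rV[rat]_d}).

Lemma tsumP X Y z :
  reflect (exists x y, [/\ x \in X, y \in Y & z = x + y *m g]) (z \in tsum g X Y).
Proof.
apply: (iffP (sumsetP _ _ _)) => [[x [? [xX /imfsetP [y /= yY ->] ->]]]|[x [y [xX yY ->]]]].
  by exists x, y.
by exists x, (y *m g); split=> //; apply/imfsetP; exists y.
Qed.

Lemma mem_tsum X Y x y : x \in X -> y \in Y -> x + y *m g \in tsum g X Y.
Proof. by move=> xX yY; apply/tsumP; exists x, y. Qed.

Lemma tsumS X Y X' Y' :
  (X `<=` X' -> Y `<=` Y' -> tsum g X Y `<=` tsum g X' Y')%fset.
Proof.
move=> /fsubsetP sX /fsubsetP sY; apply/fsubsetP => z /tsumP [x [y [xX yY ->]]].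
by apply: mem_tsum; [apply: sX | apply: sY].
Qed.

(** Multiplication by [g] takes [x + y g^-1] to [y + x g]. Through this every statement about [g]
    can be reused for [g^-1]. *)
Lemma card_tsum_inv X Y : #|` tsum (invmx g) X Y| = #|` tsum g Y X|.
Proof.
have -> : tsum (invmx g) X Y = [fset z *m invmx g | z in tsum g Y X]%fset.
  apply/fsetP => z; apply/sumsetP/imfsetP => /=.
    move=> [x [? [xX /imfsetP [y /= yY ->] ->]]].
    exists (y + x *m g); first exact: mem_tsum.
    by rewrite mulmxDl mulmxK // addrC.
  move=> [? /tsumP [y [x [yY xX ->]]] ->]; exists x, (y *m invmx g).
  by rewrite mulmxDl mulmxK // addrC; split=> //; apply/imfsetP; exists y.
by apply: card_imfset => x y e; rewrite -[x](mulmxKV ug) e mulmxKV.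
Qed.

Definition subgroup (P : 'rV[rat]_d -> Prop) : Prop :=
  P 0 /\ forall x y, P x -> P y -> P (x - y).

Lemma subgroupN P x : subgroup P -> P x -> P (- x).
Proof. by move=> [P0 PB] Px; rewrite -sub0r; apply: PB. Qed.

Lemma subgroupD P x y : subgroup P -> P x -> P y -> P (x + y).
Proof.
by move=> sP Px Py; rewrite -[y]opprK; apply: sP.2 => //; apply: subgroupN.
Qed.

Definition dclass (Gam : 'rV[rat]_d -> Prop) A (b : 'rV[rat]_d) : {fset 'rV[rat]_d} :=
  [fset a in A | `[< Gam ((a - b) *m g) >]]%fset.

Lemma dclassP Gam A b a :
  reflect (a \in A /\ Gam ((a - b) *m g)) (a \in dclass Gam A b).
Proof.
rewrite !inE /=; apply: (iffP andP) => [[aA /asboolP ?]//|[aA h]]; split=> //; exact/asboolP.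
Qed.

Lemma dclass_sub Gam A b : (dclass Gam A b `<=` A)%fset.
Proof. by apply/fsubsetP => a /dclassP []. Qed.

Variable Gam : 'rV[rat]_d -> Prop.
Hypothesis sG : subgroup Gam.

Lemma mem_dclass A b : b \in A -> b \in dclass Gam A b.
Proof. by move=> bA; apply/dclassP; rewrite subrr mul0mx; split=> //; exact: sG.1. Qed.

(** From [x + y g = x' + y' g] follows [(y' - y) g = x - x'], which is in [Gam]; so [y'] would lie
    in the class of [y]. *)
Lemma tsum_dclass_disjoint A b : (forall x y, x \in A -> y \in A -> Gam (x - y)) ->
  forall z, z \in tsum g A (dclass Gam A b) ->
    z \notin tsum g (A `\` dclass Gam A b)%fset (A `\` dclass Gam A b)%fset.
Proof.
move=> AG z /tsumP [x [y [xA /dclassP [yA yb] ->]]]; apply/negP.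
move=> /tsumP [x' [y' [x'A y'A e]]].
move: x'A y'A; rewrite !in_fsetD => /andP [_ x'A] /andP [/negP y'C y'A].
apply: y'C; apply/dclassP; split=> //.
have e' : y' *m g = x - x' + y *m g by rewrite addrAC e addrC addKr.
have -> : (y' - b) *m g = (y - b) *m g + (x - x').
  by rewrite !mulmxBl e' -addrA addrC.
by apply: subgroupD => //; apply: AG.
Qed.

End Classes.

Lemma sum_card_disjoint (T : choiceType) (m : nat) (F : 'I_m -> {fset T}) (S : {fset T}) :
  (forall p, F p `<=` S)%fset ->
  (forall p q x, x \in F p -> x \in F q -> p = q) ->
  (\sum_(p < m) #|` F p| <= #|` S|)%N.
Proof.
move=> sub dj.
have e p : #|` F p| = (\sum_(x <- S) (x \in F p))%N.
  have eF : F p = [fset x in S | x \in F p]%fset.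
    apply/fsetP => x; rewrite !inE /=.
    by apply/idP/andP => [h|[]//]; split=> //; move/fsubsetP: (sub p); apply.
  rewrite {1}eF card_fset_sum1 big_fset /= big_mkcond /=.
  by apply: eq_bigr => x _; case: ifP.
rewrite (eq_bigr _ (fun p _ => e p)) exchange_big /= [X in (_ <= X)%N]card_fset_sum1.
apply: leq_sum => x _.
have [/existsP [p xp]|/existsPn hN] := boolP [exists p, x \in F p].
  rewrite (bigD1 p) //= xp big1 // => q qp; case: (boolP (x \in F q)) => // xq.
  by move: qp; rewrite (dj _ _ _ xq xp) eqxx.
by rewrite big1 // => p _; rewrite (negbTE (hN p)).
Qed.

Section NearCounterexamples.
Variables (R : realType) (K D s : R) (d : nat).
Hypotheses (K1 : 1 <= K) (D0 : 0 < D) (s0 : 0 < s) (s1 : s < 1).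
Implicit Types (g : 'M[rat]_d) (A B C X Y : {fset 'rV[rat]_d}).

Definition err A : R := D * (#|` A|)%:R `^ (1 - s).

Definition bounded_below g A : Prop := K * (#|` A|)%:R - err A <= (#|` tsum g A A|)%:R.

(** [e] is the fraction of the error term already given away: [e = 0] negates [bounded_below], and a
    passage to a class raises [e] to [2 K (s + e)]. *)
Definition near_counterexample g (e : R) A : Prop :=
  (#|` tsum g A A|)%:R < K * (#|` A|)%:R - (1 - e) * err A.

Definition subsets_bounded g A : Prop :=
  forall B, (B `<=` A)%fset -> B != A -> bounded_below g B.

Lemma bounded_below_inv g A : g \in unitmx -> bounded_below (invmx g) A <-> bounded_below g A.
Proof. by move=> ug; rewrite /bounded_below card_tsum_inv. Qed.

Lemma near_counterexample_inv g e A : g \in unitmx ->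
  near_counterexample (invmx g) e A <-> near_counterexample g e A.
Proof. by move=> ug; rewrite /near_counterexample card_tsum_inv. Qed.

Lemma subsets_bounded_inv g A : g \in unitmx ->
  subsets_bounded g A -> subsets_bounded (invmx g) A.
Proof. by move=> ug h B BA BnA; apply/bounded_below_inv => //; apply: h. Qed.

Lemma class_step g (Gam : 'rV[rat]_d -> Prop) A b e : g \in unitmx -> subgroup Gam ->
  (forall x y, x \in A -> y \in A -> Gam (x - y)) -> b \in A ->
  0 <= e -> 4 * K * (s + e) <= 1 ->
  subsets_bounded g A -> near_counterexample g e A ->
  let C := dclass g Gam A b in
  [/\ (#|` A|)%:R <= 2 * K * (#|` C|)%:R :> R,
      near_counterexample g (2 * K * (s + e)) C,
      (#|` tsum g A C|)%:R - (#|` tsum g C C|)%:R < 2 * K * (s + e) * (#|` A|)%:R &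
      (#|` tsum g A C|)%:R + err A / (4 * K) < K * (#|` C|)%:R].
Proof.
move=> ug sG AG bA e0 hse hered near C.
have CA : (C `<=` A)%fset by apply: dclass_sub.
have bC : b \in C by apply: mem_dclass.
have cC : (0 < #|` C|)%N by rewrite cardfs_gt0; apply/fset0Pn; exists b.
have cAC : #|` A| = (#|` C| + #|` A `\` C|%fset)%N.
  by rewrite cardfsDS // subnKC // fsubset_leq_card.
have goodR : bounded_below g (A `\` C)%fset.
  apply: hered; first exact: fsubsetDl.
  by apply/eqP => e1; move: cAC; rewrite e1; move: cC; lia.
have UT : (tsum g A C `<=` tsum g A A)%fset by apply: tsumS => //; exact: fsubset_refl.
have TU : (tsum g C C `<=` tsum g A C)%fset by apply: tsumS => //; exact: fsubset_refl.
have RT : (tsum g (A `\` C) (A `\` C) `<=` tsum g A A)%fset.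
  by apply: tsumS; exact: fsubsetDl.
have dj : (tsum g A C `&` tsum g (A `\` C) (A `\` C) = fset0)%fset.
  apply/fsetP => z; rewrite in_fsetI in_fset0; apply/negP => /andP [z1 z2].
  by have := tsum_dclass_disjoint sG AG z1; rewrite z2.
have cU : (#|` tsum g A C| + #|` tsum g (A `\` C)%fset (A `\` C)%fset| <= #|` tsum g A A|)%N.
  rewrite -cardfsUI dj cardfs0 addn0; apply: fsubset_leq_card.
  by rewrite fsubUset UT RT.
have AU : (#|` A| <= #|` tsum g A C|)%N.
  by apply: (card_sumset_ger A (b := mulmxr g b)); apply/imfsetP; exists b.
have nE : (#|` A|)%:R = (#|` C|)%:R + (#|` A `\` C|)%fset%:R :> R by rewrite {1}cAC natrD.
have cC' : 0 < (#|` C|)%:R :> R by rewrite ltr0n.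
have AU' : (#|` A|)%:R <= (#|` tsum g A C|)%:R :> R by rewrite ler_nat.
have cU' : (#|` tsum g A C|)%:R + (#|` tsum g (A `\` C)%fset (A `\` C)%fset|)%:R <=
    (#|` tsum g A A|)%:R :> R by rewrite -natrD ler_nat.
have TU' : (#|` tsum g C C|)%:R <= (#|` tsum g A C|)%:R :> R.
  by rewrite ler_nat fsubset_leq_card.
have [i1 i2 i3 i4] := class_arith K1 D0 s0 s1 e0 hse nE (ler0n _ _) cC' AU' cU' TU'
  (ler0n _ _) near goodR.
split=> //.
(* Minimality speaks of proper subsets only; if the class is all of [A], the difference is zero. *)
have [CeA|CnA] := eqVneq C A; last exact/i3/hered.
rewrite CeA subrr; apply: mulr_gt0; last by rewrite -CeA.
apply: mulr_gt0; last by apply: ltr_wpDr.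
by apply: mulr_gt0 => //; apply: lt_le_trans K1.
Qed.

(** As [A + C g] exceeds [C + C g] by less than [|A| / (2 K)], any subset of that size of the former
    meets the latter. Applied to [I + c g] with [I] another class, this makes the residues of [C g]
    modulo [Lam] stable under translation by [A - A], hence by [Gam], so that they include
    translates of all [ga p]. Applied to [a + C g], it gives the last clause, by which points of [A]
    can later be moved into [C]. *)
Lemma fill_step g (Gam : 'rV[rat]_d -> Prop) A e m (ga : 'I_m -> 'rV[rat]_d) :
  g \in unitmx -> A != fset0 -> subgroup Gam ->
  (forall x y, x \in A -> y \in A -> Gam (x - y)) ->
  (forall P, subgroup P -> (forall x y, x \in A -> y \in A -> P (x - y)) ->
     forall x, Gam x -> P x) ->
  (forall p, Gam (ga p)) -> (forall p q, Gam ((ga p - ga q) *m g) -> p = q) ->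
  0 <= e -> 4 * K ^+ 2 * (s + e) <= 1 ->
  subsets_bounded g A -> near_counterexample g e A ->
  let Lam x := Gam x /\ Gam (x *m g) in
  exists C, exists c : 'I_m -> 'rV[rat]_d,
   [/\ (C `<=` A)%fset /\ C != fset0, near_counterexample g (2 * K * (s + e)) C,
      (#|` A|)%:R <= 2 * K * (#|` C|)%:R :> R,
      (forall x y, x \in C -> y \in C -> Lam (x - y)) &
      [/\ forall p, c p \in C, forall p q, Lam ((c p - c q) *m g) -> p = q &
       forall a, a \in A -> exists2 x, x \in C & Lam ((a - x) *m invmx g)] ].
Proof.
move=> ug /fset0Pn [b bA] sG AG gen gaG gaI e0 hse hered near Lam.
have hK := K1; have hs := s0.
have hse' : 4 * K * (s + e) <= 1.
  apply: le_trans hse; apply: ler_wpM2r; first by lra.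
  by rewrite ler_pM2l // expr2 ler_peMl //; lra.
pose C := dclass g Gam A b.
have [i1 i2 i3 _] := class_step ug sG AG bA e0 hse' hered near.
rewrite -/C in i1 i2 i3.
have CA x : x \in C -> x \in A by move=> /dclassP [].
have bC : b \in C by apply: mem_dclass.
have sL : subgroup Lam.
  split; first by rewrite /Lam mul0mx; split; exact: sG.1.
  move=> x y [x1 x2] [y1 y2]; split; first exact: sG.2.
  by rewrite mulmxBl; apply: sG.2.
have CL x y : x \in C -> y \in C -> Lam (x - y).
  move=> xC yC; split; first by apply: AG; apply: CA.
  have /dclassP [_ h1] := xC; have /dclassP [_ h2] := yC.
  rewrite (_ : (x - y) *m g = (x - b) *m g - (y - b) *m g); first exact: sG.2.
  by rewrite -mulmxBl opprB addrA subrK.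
have tele (x y z : 'rV[rat]_d) : z - x = (y - x) + (z - y).
  by rewrite [RHS]addrC addrA subrK.
have meets (I : {fset 'rV[rat]_d}) (f : 'rV[rat]_d -> 'rV[rat]_d) : injective f ->
    (#|` A|)%:R <= 2 * K * (#|` I|)%:R :> R -> (forall x, x \in I -> f x \in tsum g A C) ->
    exists2 x, x \in I & f x \in tsum g C C.
  move=> fI hI fU; pose E := [fset f x | x in I]%fset.
  have cE : #|` E| = #|` I| by apply: card_imfset.
  have [/eqP dj|] := boolP ((E `&` tsum g C C)%fset == fset0); last first.
    move=> /fset0Pn [z]; rewrite in_fsetI => /andP [/imfsetP [x /= xI ->] h].
    by exists x.
  exfalso.
  have : (#|` E| + #|` tsum g C C| <= #|` tsum g A C|)%N.
    rewrite -cardfsUI dj cardfs0 addn0; apply: fsubset_leq_card; rewrite fsubUset.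
    apply/andP; split.
      by apply/fsubsetP => z /imfsetP [x /= xI ->]; apply: fU.
    by apply: tsumS; [apply: dclass_sub | exact: fsubset_refl].
  rewrite -(ler_nat R) natrD cE => hle.
  have h1 : (#|` I|)%:R < 2 * K * (s + e) * (#|` A|)%:R by lra.
  have h2 : 2 * K * (#|` I|)%:R < 2 * K * (2 * K * (s + e) * (#|` A|)%:R).
    by rewrite ltr_pM2l //; lra.
  have h3 : 4 * K ^+ 2 * (s + e) * (#|` A|)%:R <= 1 * (#|` A|)%:R by apply: ler_wpM2r.
  have h4 : 2 * K * (2 * K * (s + e) * (#|` A|)%:R) = 4 * K ^+ 2 * (s + e) * (#|` A|)%:R by ring.
  lra.
(* [Q y] says that translation by [y] maps the residues of [C g] modulo [Lam] into themselves. *)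
pose Q y := forall c, c \in C -> exists2 c', c' \in C & Lam ((c' - c) *m g - y).
have Q0 : Q 0.
  by move=> c cC; exists c => //; rewrite subrr mul0mx subr0; exact: sL.1.
have QD x y : Q x -> Q y -> Q (x + y).
  move=> Qx Qy c cC; have [c1 c1C h1] := Qx c cC; have [c2 c2C h2] := Qy c1 c1C.
  exists c2 => //.
  rewrite (_ : _ - _ = ((c1 - c) *m g - x) + ((c2 - c1) *m g - y)); first exact: subgroupD.
  by rewrite addrACA -mulmxDl -opprD [c1 - c + _]addrC addrA subrK.
have QMn x n : Q x -> Q (x *+ n).
  by move=> Qx; elim: n => [|n IH]; rewrite ?mulr0n // mulrS; apply: QD.
have QN y : Q y -> Q (- y).
  move=> Qy.
  have exF c : exists c', (c \in C) ==> (c' \in C) && `[< Lam ((c' - c) *m g - y) >].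
    have [/Qy [c' c'C h]|_] := boolP (c \in C); last by exists 0.
    by exists c'; rewrite c'C /=; apply/asboolP.
  pose F c := xchoose (exF c).
  have FP c : c \in C -> F c \in C /\ Lam ((F c - c) *m g - y).
    by move=> cC; have /implyP/(_ cC)/andP [? /asboolP] := xchooseP (exF c).
  have FC n : iter n F b \in C by elim: n => //= n IH; case: (FP _ IH).
  have FD i n : Lam ((iter (n + i) F b - iter i F b) *m g - y *+ n).
    elim: n => [|n IH]; first by rewrite add0n subrr mul0mx subr0; exact: sL.1.
    have [_ h] := FP _ (FC (n + i)%N).
    rewrite (_ : _ - _ = ((iter (n + i) F b - iter i F b) *m g - y *+ n) +
      ((F (iter (n + i) F b) - iter (n + i) F b) *m g - y)); first exact: subgroupD.
    by rewrite /= (tele (iter i F b) (iter (n + i) F b)) mulmxDl mulrSr opprD addrACA.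
  (* [C] is finite, so the orbit of [b] under [F] repeats and a positive multiple of [y] is in
     [Lam]; then [- y] is congruent to a nonnegative multiple of [y]. *)
  have [n n0 hn] : exists2 n, (0 < n)%N & Lam (y *+ n).
    have : ~~ uniq [seq iter n F b | n <- iota 0 (#|` C|).+1].
      apply/negP => u.
      have : {subset [seq iter n F b | n <- iota 0 (#|` C|).+1] <= C}.
        by move=> z /mapP [n _ ->].
      by move=> /(uniq_leq_size u); rewrite size_map size_iota ltnn.
    move=> /(uniqPn 0) [i [j [ij]]]; rewrite size_map size_iota => jC.
    rewrite !(nth_map 0%N) ?size_iota ?(ltn_trans ij) // !nth_iota ?(ltn_trans ij) // !add0n => eij.
    exists (j - i)%N; first by rewrite subn_gt0.
    have := FD i (j - i)%N; rewrite subnK ?(ltnW ij) // -eij subrr mul0mx sub0r.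
    by move=> /(subgroupN sL); rewrite opprK.
  case: n n0 hn => // n _ hn c cC.
  have [c' c'C h] := QMn y n Qy c cC; exists c' => //.
  rewrite opprK (_ : _ + y = ((c' - c) *m g - y *+ n) + y *+ n.+1); first exact: subgroupD.
  by rewrite mulrSr addrA subrK.
have sQ : subgroup Q by split=> // x y Qx Qy; apply: QD => //; apply: QN.
have Qa a : a \in A -> Q (a - b).
  move=> aA c cC.
  have [j1 _ _ _] := class_step ug sG AG aA e0 hse' hered near.
  (* A common point [a' + c g = c' + c2 g] gives [(c2 - c) g = a' - c'], congruent to [a - b] modulo
     [Lam] as [a'] and [c'] lie in the classes of [a] and [b]. *)
  have [|a' /dclassP [a'A ha'] /tsumP [c' [c2 [c'C c2C eq]]]] :=
    meets (dclass g Gam A a) (fun x => x + c *m g) (addIr _) j1.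
    by move=> x /dclassP [xA _]; apply: mem_tsum.
  exists c2 => //.
  rewrite (_ : _ - _ = (a' - a) - (c' - b)).
    apply: sL.2; last exact: CL.
    by split=> //; apply: AG.
  have e1 : (c2 - c) *m g = a' - c'.
    by rewrite mulmxBl; apply/eqP; rewrite subr_eq addrAC eq addrC addKr.
  by rewrite e1 !opprB addrACA [RHS]addrACA [- c' - a]addrC.
have QG x : Gam x -> Q x.
  apply: gen => // {}x y xA yA.
  rewrite (_ : x - y = (x - b) - (y - b)); last by rewrite opprB addrA subrK.
  by apply: sQ.2; apply: Qa.
have cex p : exists c', (c' \in C) && `[< Lam ((c' - b) *m g - ga p) >].
  by have [c' c'C h] := QG _ (gaG p) b bC; exists c'; rewrite c'C; apply/asboolP.
pose c p := xchoose (cex p).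
have cP p : c p \in C /\ Lam ((c p - b) *m g - ga p).
  by have /andP [? /asboolP] := xchooseP (cex p).
exists C, c; split=> //.
- by split; [apply: dclass_sub | apply/fset0Pn; exists b].
- split; first by move=> p; case: (cP p).
  + move=> p q h; apply: gaI.
    have [_ hp] := cP p; have [_ hq] := cP q.
    have : Lam (ga p - ga q).
      rewrite (_ : ga p - ga q = (c p - c q) *m g - (((c p - b) *m g - ga p) - ((c q - b) *m g - ga q))).
        by apply: sL.2 => //; apply: sL.2.
      have alg (P Q' u v : 'rV[rat]_d) : (P - u) - (Q' - v) = (P - Q') - (u - v).
        by rewrite !opprB addrACA [RHS]addrACA [- u - Q']addrC.
      rewrite alg (_ : (c p - c q) *m g = (c p - b) *m g - (c q - b) *m g) ?subKr //.
      by rewrite -mulmxBl opprB addrA subrK.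
    by case.
  + move=> a aA.
    have finj : injective (fun x : 'rV[rat]_d => a + x *m g).
      by move=> x y /addrI e'; rewrite -[x](mulmxK ug) e' mulmxK.
    have [|x xC /tsumP [c2 [c' [c2C c'C eq]]]] := meets C _ finj i1.
      by move=> x xC; apply: mem_tsum.
    exists c2 => //.
    rewrite (_ : (a - c2) *m invmx g = c' - x); first exact: CL.
    rewrite (_ : a - c2 = (c' - x) *m g) ?mulmxK // mulmxBl; apply/eqP.
    by rewrite subr_eq addrAC eq_sym subr_eq eq addrC.
Qed.

End NearCounterexamples.

(** * Bounds inside [A], difference lattices, and the closing inequality *)

Lemma sumset_lower_bound (R : realType) d (X Y : {fset 'rV[rat]_d.+1})
    (W : 'M[rat]_d.+1) N (E x y : R) :
  W \in unitmx -> (0 < N)%N ->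
  (forall i, (#|` sumset (sumset X Y) (apset N (row i W))|)%:R <= N%:R * E) ->
  X != fset0 -> Y != fset0 -> 0 <= x -> 0 <= y ->
  x ^+ d.+1 <= (#|` X|)%:R -> y ^+ d.+1 <= (#|` Y|)%:R ->
  (x + y) ^+ d.+1 <= (#|` sumset X Y|)%:R + (2 ^ d.+1 * d.+1)%:R * E.
Proof.
(* The change of coordinates [W^-1] turns the thin directions into the axes of [proj_sum_thick]. *)
move=> uW N0 hE X0 Y0 x0 y0 hx hy.
pose f z := z *m invmx W : 'rV[rat]_d.+1.
pose im (S : {fset 'rV[rat]_d.+1}) := [fset f z | z in S]%fset.
have finj : injective f by move=> u v e; rewrite -[u](mulmxKV uW) -/(f u) e mulmxKV.
have card_im S : #|` im S| = #|` S| by apply: card_imfset.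
have imD S T : sumset (im S) (im T) = im (sumset S T).
  apply/fsetP => z; apply/sumsetP/imfsetP => /=.
    move=> [? [? [/imfsetP [u /= uS ->] /imfsetP [v /= vT ->] ->]]].
    by exists (u + v); [apply: mem_sumset | rewrite /f mulmxDl].
  move=> [? /sumsetP [u [v [uS vT ->]]] ->]; exists (f u), (f v).
  by rewrite /f mulmxDl; split=> //; apply/imfsetP; [exists u | exists v].
have im_ap i : apset N (delta_mx ord0 i) = im (apset N (row i W)).
  have e : f (row i W) = delta_mx ord0 i by rewrite /f -row_mul mulmxV // row1.
  have eM c : f (row i W *+ c) = delta_mx ord0 i *+ c.
    by rewrite -e /f; elim: c => [|c IH]; rewrite ?mulr0n ?mul0mx // !mulrS mulmxDl IH.
  apply/fsetP => z; apply/apsetP/imfsetP => /=.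
    by move=> [c cN ->]; exists (row i W *+ c); rewrite ?eM //; apply/apsetP; exists c.
  by move=> [? /apsetP [c cN ->] ->]; exists c; rewrite ?eM.
have im0 S : S != fset0 -> im S != fset0 by rewrite -!cardfs_gt0 card_im.
have bm := @brunn_minkowski R d (im X) (im Y) x y (im0 _ X0) (im0 _ Y0) x0 y0.
rewrite !card_im imD in bm; apply: le_trans (bm hx hy) _.
have := proj_sum_thick (im (sumset X Y)) N0; rewrite card_im -(ler_nat R).
rewrite natrM natrD !natrM natr_sum => th.
have NR : 0 < N%:R :> R by rewrite ltr0n.
rewrite -(ler_pM2l NR); apply: le_trans th _.
rewrite mulrDr lerD2l -mulrA mulrCA; apply: ler_wpM2l => //.
apply: (@le_trans _ _ (\sum_(i < d.+1) N%:R * E)).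
  by apply: ler_sum => i _; rewrite im_ap imD card_im.
by rewrite sumr_const card_ord -mulrnAr -(mulr_natl E).
Qed.

(** If [M] had smaller rank, some row [w] of [W] would lie outside its span, and the [a + c w] would
    be [|A| N] distinct points. *)
Lemma full_rank_of_thin d N' (A : {fset 'rV[rat]_d}) (b : 'rV[rat]_d)
    (W : 'M[rat]_d) N (M : 'M[rat]_(N', d)) :
  W \in unitmx -> (forall i, (#|` sumset A (apset N (row i W))| < #|` A| * N)%N) ->
  (forall a, a \in A -> (a - b <= M)%MS) -> \rank M = d.
Proof.
move=> uW thin AM; apply/eqP; rewrite eqn_leq rank_leq_col /= leqNgt; apply/negP => lt.
have [i wi] : exists i, ~~ (row i W <= M)%MS.
  apply/existsP; apply: contraTT lt => /existsPn h; rewrite -leqNgt -{1}(mxrank_unit uW).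
  by apply: mxrankS; apply/row_subP => i; rewrite -[(_ <= _)%MS]negbK h.
have := thin i; rewrite ltnNge => /negP; apply.
pose I := [fset c in iota 0 N]%fset.
have cI : #|` I| = N by rewrite card_fseq undup_id ?iota_uniq // size_iota.
rewrite -[X in (_ * X <= _)%N]cI.
apply: (@card_ge_prod _ _ _ (fun (a : 'rV[rat]_d) (c : nat) => a + row i W *+ c)).
  move=> a c aA; rewrite inE /= mem_iota add0n => /andP [_ cN].
  by apply: mem_sumset => //; apply/apsetP; exists c.
have key (a a' : 'rV[rat]_d) (c c' : nat) : a \in A -> a' \in A ->
    a + row i W *+ c = a' + row i W *+ c' -> c = c'.
  move=> aA aA' e; apply/eqP; apply: contraR wi => cc.
  have h : ((c%:R - c'%:R) *: row i W <= M)%MS.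
    rewrite scalerBl !scaler_nat.
    have -> : row i W *+ c - row i W *+ c' = (a' - b) - (a - b).
      rewrite opprB addrA subrK; apply/eqP; rewrite subr_eq addrAC eq_sym subr_eq.
      by rewrite -e addrC.
    by apply: addmx_sub; rewrite ?eqmx_opp AM.
  have nz : (c%:R - c'%:R : rat) != 0 by rewrite subr_eq0 eqr_nat.
  by rewrite -[row i W](scalerK nz) scalemx_sub.
move=> a c a' c' aA _ aA' _ e; have cc := key _ _ _ _ aA aA' e.
by split=> //; move: e; rewrite cc => /addIr.
Qed.

(** The [a - b] generate the least subgroup containing [A - A]; the third clause is this leastness,
    used to carry properties from [A - A] to the whole lattice. *)
Lemma diff_lattice d (A : {fset 'rV[rat]_d}) b :
  b \in A -> (forall a, a \in A -> exists z : 'rV[int]_d, a = ratmx z) ->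
  exists N, exists B : 'M[int]_(N, d),
   [/\ subgroup (in_lattice B), forall x y, x \in A -> y \in A -> in_lattice B (x - y),
     forall P, subgroup P -> (forall x y, x \in A -> y \in A -> P (x - y)) ->
       forall x, in_lattice B x -> P x &
     forall a, a \in A -> (a - b <= ratmx B)%MS].
Proof.
move=> bA intA; pose zof (a : 'rV[rat]_d) : 'rV[int]_d := map_mx numq a.
have zofK a : a \in A -> ratmx (zof a) = a.
  by move=> /intA [z ->]; apply/rowP => i; rewrite !mxE numq_int.
pose N := #|` A|.
pose B : 'M[int]_(N, d) := \matrix_(i < N) (zof (nth 0 A i) - zof b).
have rowB (i : 'I_N) : ratmx (row i B) = nth 0 A i - b.
  by rewrite rowK ratmxB !zofK //; apply: mem_nth; exact: ltn_ord.
have sB : subgroup (in_lattice B).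
  split; first by exists 0; rewrite mul0mx; apply/rowP => i; rewrite !mxE.
  by move=> x y [u ->] [v ->]; exists (u - v); rewrite mulmxBl ratmxB.
have AB a : a \in A -> in_lattice B (a - b).
  move=> aA; have h : (index a A < N)%N by rewrite index_mem.
  exists (delta_mx 0 (Ordinal h)); rewrite -rowE rowB /= nth_index //.
exists N, B; split=> //.
- move=> x y xA yA; rewrite (_ : x - y = (x - b) - (y - b)); last by rewrite opprB addrA subrK.
  by apply: sB.2; apply: AB.
- move=> P sP PA x [y ->].
  have PMn v n : P v -> P (v *+ n).
    move=> Pv; elim: n => [|n IH]; first by rewrite mulr0n; exact: sP.1.
    by rewrite mulrS; apply: subgroupD.
  have PMz v (z : int) : P v -> P (z%:~R *: v).
    move=> Pv; case: z => n; first by rewrite -pmulrn scaler_nat; apply: PMn.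
    by rewrite NegzE mulrNz scaleNr -pmulrn scaler_nat; apply: subgroupN => //; apply: PMn.
  have -> : ratmx (y *m B) = \sum_i (y 0 i)%:~R *: (nth 0 A i - b).
    rewrite ratmxM mulmx_sum_row; apply: eq_bigr => i _; rewrite ratmxE; congr (_ *: _).
    by rewrite -rowB; apply/rowP => k; rewrite !mxE.
  apply: (big_ind P); first exact: sP.1.
    by move=> u v; apply: subgroupD.
  by move=> i _; apply: PMz; apply: PA => //; apply: mem_nth; exact: ltn_ord.
- by move=> a /AB [y ->]; rewrite ratmxM; exact: submxMl.
Qed.

(** Let [I_q] be the class of [f q] for [g^-1] and [J] that of [b] for [g]. The sets [I_q + J g] are
    pairwise disjoint, since [x + v g = x' + v' g] puts [(x - x') g^-1 = v' - v] in [Gam]. Their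
    Brunn-Minkowski bounds add up inside [A + J g], and the margin in the last clause of
    [class_step] absorbs the errors. *)
Lemma final_half (R : realType) (K D s e a y E : R) d (g : 'M[rat]_d.+1)
    (A : {fset 'rV[rat]_d.+1}) Gam m (f : 'I_m -> 'rV[rat]_d.+1) b :
  1 <= K -> 0 < D -> 0 < s -> s < 1 -> 0 <= e -> 4 * K * (s + e) <= 1 ->
  g \in unitmx -> subgroup Gam -> (forall u v, u \in A -> v \in A -> Gam (u - v)) ->
  subsets_bounded K D s g A -> near_counterexample K D s g e A ->
  (forall q, f q \in A) -> (forall q q', Gam ((f q - f q') *m invmx g) -> q = q') ->
  b \in A -> 0 <= a -> 0 <= y ->
  (forall q, a ^+ d.+1 <= (#|` dclass (invmx g) Gam A (f q)|)%:R) ->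
  y ^+ d.+1 <= (#|` dclass g Gam A b|)%:R ->
  (forall X Y x z, (X `<=` A)%fset -> (Y `<=` A)%fset -> X != fset0 -> Y != fset0 ->
     0 <= x -> 0 <= z -> x ^+ d.+1 <= (#|` X|)%:R -> z ^+ d.+1 <= (#|` Y|)%:R ->
     (x + z) ^+ d.+1 <= (#|` tsum g X Y|)%:R + E) ->
  m%:R * E <= err D s A / (4 * K) ->
  m%:R * (a + y) ^+ d.+1 < K * (#|` dclass g Gam A b|)%:R.
Proof.
move=> K1 D0 s0 s1 e0 hse ug sG AG hered near fA fI bA a0 y0 ha hy bm hE.
have [_ _ _ i4] := class_step K1 D0 s0 s1 ug sG AG bA e0 hse hered near.
set J := dclass g Gam A b in hy i4 *.
apply: le_lt_trans i4.
have JA : (J `<=` A)%fset by apply: dclass_sub.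
have J0 : J != fset0 by apply/fset0Pn; exists b; apply: mem_dclass.
have sums : (\sum_(q < m) #|` tsum g (dclass (invmx g) Gam A (f q)) J| <= #|` tsum g A J|)%N.
  apply: sum_card_disjoint.
    by move=> q; apply: tsumS; [apply: dclass_sub | exact: fsubset_refl].
  move=> q q' z /tsumP [x [v [/dclassP [xA hx] vJ ->]]] /tsumP [x' [v' [/dclassP [x'A hx'] vJ' eq]]].
  apply: fI.
  have e1 : (x - x') *m invmx g = v' - v.
    rewrite (_ : x - x' = (v' - v) *m g) ?mulmxK // mulmxBl; apply/eqP.
    by rewrite subr_eq addrAC eq_sym subr_eq eq addrC.
  have h1 : Gam ((x - x') *m invmx g).
    by rewrite e1; apply: AG; [move: vJ' | move: vJ] => /dclassP [].
  rewrite (_ : f q - f q' = (x - x') - ((x - f q) - (x' - f q'))).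
    by rewrite mulmxBl; apply: sG.2 => //; rewrite mulmxBl; apply: sG.2.
  rewrite (_ : (x - f q) - (x' - f q') = (x - x') - (f q - f q')) ?subKr //.
  by rewrite !opprB addrACA [RHS]addrACA [- f q - x']addrC.
move: sums; rewrite -(ler_nat R) natr_sum => sums.
have : \sum_(q < m) ((a + y) ^+ d.+1 - E) <= (#|` tsum g A J|)%:R.
  apply: le_trans sums; apply: ler_sum => q _; rewrite lerBlDr; apply: bm => //.
    exact: dclass_sub.
  by apply/fset0Pn; exists (f q); apply: mem_dclass.
rewrite sumr_const card_ord -(mulr_natl (_ - E)) mulrBr => h.
lra.
Qed.

Section Dilate.
Variables (d : nat) (L1 L2 : 'M[int]_d).
Hypotheses (L10 : \det L1 != 0) (L20 : \det L2 != 0).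

Lemma dilate_unit : dilate L1 L2 \in unitmx.
Proof. by rewrite unitmx_mul unitmx_inv !unitmx_tr !unit_ratmx L10 L20. Qed.

Lemma dilate_inv : invmx (dilate L1 L2) = dilate L2 L1.
Proof.
have u1 : (ratmx L1)^T \in unitmx by rewrite unitmx_tr unit_ratmx.
have u2 : (ratmx L2)^T \in unitmx by rewrite unitmx_tr unit_ratmx.
have e : dilate L2 L1 *m dilate L1 L2 = 1%:M.
  by rewrite /dilate mulmxA mulmxKV // mulmxV.
by rewrite -[LHS]mul1mx -e mulmxK // dilate_unit.
Qed.

Lemma dilate_irreducible : irreducible_mats [:: L1; L2] ->
  no_invariant_subspace (dilate L1 L2).
Proof.
have u1 : (ratmx L1)^T \in unitmx by rewrite unitmx_tr unit_ratmx.
move=> irr U U0 Ud inv; apply: irr; exists U, (U *m (ratmx L1)^T); split=> //.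
  by rewrite mxrankMfree // row_free_unit.
move=> L; rewrite !inE => /orP [/eqP ->|/eqP ->]; first exact: submx_refl.
by rewrite -[(ratmx L2)^T](mulmxKV u1) mulmxA; apply: submxMr.
Qed.

End Dilate.

Lemma final_contradiction (R : realType) (K D s e E mu1 mu2 : R) d (g : 'M[rat]_d.+1)
    (A : {fset 'rV[rat]_d.+1}) Gam m1 m2 (c1 : 'I_m1 -> 'rV[rat]_d.+1) (c2 : 'I_m2 -> 'rV[rat]_d.+1) :
  1 <= K -> 0 < D -> 0 < s -> s < 1 -> 0 <= e -> 4 * K * (s + e) <= 1 ->
  (0 < m1)%N -> (0 < m2)%N -> 0 <= mu1 -> 0 <= mu2 ->
  mu1 ^+ d.+1 = m1%:R -> mu2 ^+ d.+1 = m2%:R -> K = (mu1 + mu2) ^+ d.+1 ->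
  g \in unitmx -> subgroup Gam -> (forall u v, u \in A -> v \in A -> Gam (u - v)) ->
  subsets_bounded K D s g A -> near_counterexample K D s g e A ->
  (forall p, c1 p \in A) -> (forall p q, Gam ((c1 p - c1 q) *m g) -> p = q) ->
  (forall p, c2 p \in A) -> (forall p q, Gam ((c2 p - c2 q) *m invmx g) -> p = q) ->
  (forall X Y x z, (X `<=` A)%fset -> (Y `<=` A)%fset -> X != fset0 -> Y != fset0 ->
     0 <= x -> 0 <= z -> x ^+ d.+1 <= (#|` X|)%:R -> z ^+ d.+1 <= (#|` Y|)%:R ->
     (x + z) ^+ d.+1 <= (#|` tsum g X Y|)%:R + E) ->
  m1%:R * E <= err D s A / (4 * K) -> m2%:R * E <= err D s A / (4 * K) -> False.
Proof.
move=> K1 D0 s0 s1 e0 hse m10 m20 mu10 mu20 emu1 emu2 eK ug sG AG hered near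
  c1A c1I c2A c2I bm hE1 hE2.
pose I q := dclass (invmx g) Gam A (c2 q); pose J p := dclass g Gam A (c1 p).
have [p _ hp] := @arg_minnP _ (Ordinal m10) xpredT (fun p => #|` J p|) isT.
have [q _ hq] := @arg_minnP _ (Ordinal m20) xpredT (fun q => #|` I q|) isT.
have [y y0 ey] := real_root d (ler0n R #|` J p|).
have [a a0 ea] := real_root d (ler0n R #|` I q|).
have ug' : invmx g \in unitmx by rewrite unitmx_inv.
have h1 := final_half K1 D0 s0 s1 e0 hse ug sG AG hered near c2A c2I (c1A p) a0 y0
  (fun q' => _) _ bm hE2.
have {}h1 : m2%:R * (a + y) ^+ d.+1 < K * (#|` J p|)%:R.
  by apply: h1 => [q'|]; rewrite ?ey // ea ler_nat; apply: hq.
have bm' X Y x z : (X `<=` A)%fset -> (Y `<=` A)%fset -> X != fset0 -> Y != fset0 ->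
     0 <= x -> 0 <= z -> x ^+ d.+1 <= (#|` X|)%:R -> z ^+ d.+1 <= (#|` Y|)%:R ->
     (x + z) ^+ d.+1 <= (#|` tsum (invmx g) X Y|)%:R + E.
  move=> XA YA X0 Y0 x0 z0 hx hz; rewrite card_tsum_inv // addrC; exact: bm.
have c1I' p' q' : Gam ((c1 p' - c1 q') *m invmx (invmx g)) -> p' = q' by rewrite invmxK; apply: c1I.
have near' := proj2 (near_counterexample_inv K D s e A ug) near.
have h2 := final_half K1 D0 s0 s1 e0 hse ug' sG AG (subsets_bounded_inv ug hered) near'
  c1A c1I' (c2A q) y0 a0 (fun q' => _) _ bm' hE1.
have {}h2 : m1%:R * (y + a) ^+ d.+1 < K * (#|` I q|)%:R.
  apply: h2 => [p'|]; last by rewrite ea.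
  by rewrite invmxK ey ler_nat; apply: hp.
(* Taking roots leaves [mu2 (a + y) < (mu1 + mu2) y] and [mu1 (y + a) < (mu1 + mu2) a], that is,
   [mu2 a < mu1 y < mu2 a]. *)
move: h1 h2; rewrite -ey -ea eK -emu1 -emu2 -!exprMn.
rewrite !ltr_pXn2r ?nnegrE ?mulr_ge0 ?addr_ge0 // => h1 h2.
lra.
Qed.

(** * The minimal counterexample *)

Definition integral_set (d : nat) (A : {fset 'rV[rat]_d}) : Prop :=
  forall a, a \in A -> exists z : 'rV[int]_d, a = ratmx z.

(** [fill_step] for [g] and then for [g^-1] gives [A1] and [A2] with losses [e1 = 2 K s] and
    [e2 = 2 K s + 4 K^2 s]; the end needs [4 K (s + e2) <= 1], whence [28 = 4 + 8 + 16]. The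
    condition with [2 K^2 C0] makes [A] too large for its big subsets to lie in a hyperplane. The
    one with [16 K^3] lets the error term of [A2], where [|A2| >= |A| / (4 K^2)], absorb the
    Brunn-Minkowski errors. *)
Lemma minimal_counterexample (R : realType) (K D s C0 s0 mu1 mu2 : R) d (L1 L2 : 'M[int]_d.+1)
    (W : 'M[rat]_d.+1) N (A : {fset 'rV[rat]_d.+1}) :
  let m1 := `|\det L1|%N in let m2 := `|\det L2|%N in
  let g := dilate L1 L2 in let n := (#|` A|)%:R : R in
  let M := (2 ^ d.+1 * d.+1)%:R * C0 in
  1 <= K -> 0 < D -> 0 < s -> s <= s0 -> s0 < 1 -> 28 * K ^+ 3 * s <= 1 -> 0 < C0 ->
  K <= D -> 2 * K ^+ 2 * C0 <= D -> 16 * K ^+ 3 * ((m1 + m2)%:R * M) <= D ->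
  (0 < m1)%N -> (0 < m2)%N -> 0 <= mu1 -> 0 <= mu2 ->
  mu1 ^+ d.+1 = m1%:R -> mu2 ^+ d.+1 = m2%:R -> K = (mu1 + mu2) ^+ d.+1 ->
  coprime_mats [:: L1; L2] -> integral_set A ->
  W \in unitmx -> (0 < N)%N ->
  (forall i, (#|` sumset (tsum g A A) (apset N (row i W))|)%:R <= N%:R * (C0 * n `^ (1 - s0))) ->
  subsets_bounded K D s g A -> near_counterexample K D s g 0 A -> False.
Proof.
move=> m1 m2 g n M K1 D0 hs ss0 s01 sK C00 KD CD MD m10 m20 mu10 mu20 emu1 emu2 eK cop intA
  uW N0 hW hered near.
have s1 : s < 1 by lra.
have L10 : \det L1 != 0 by rewrite -absz_gt0.
have L20 : \det L2 != 0 by rewrite -absz_gt0.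
have ug : g \in unitmx by apply: dilate_unit.
have ug' : invmx g \in unitmx by rewrite unitmx_inv.
have nearE : D * n `^ (1 - s) < K * n.
  move: near; rewrite /near_counterexample /err subr0 mul1r -/n.
  have : 0 <= (#|` tsum g A A|)%:R :> R by []. lra.
have A0 : A != fset0.
  apply/eqP => e; move: nearE; rewrite /n e cardfs0 mulr0 ltNge mulr_ge0 ?powR_ge0 //.
  exact: ltW.
have n1 : 1 <= n by rewrite ler1n cardfs_gt0.
have n0 : 0 < n by lra.
have [b bA] := fset0Pn _ A0.
have powB (t : R) : n `^ (1 - t) = n / n `^ t.
  rewrite powRD; last by rewrite (gt_eqF n0) implybT.
  by rewrite powRr1 ?powRN // ltW.
have pgt (t : R) : 0 < n `^ t by apply: powR_gt0.
have DKp : D < K * n `^ s.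
  move: nearE; rewrite powB mulrA ltr_pdivrMr //; rewrite -mulrA [n * _]mulrC mulrA.
  by rewrite ltr_pM2r.
have p0 : n `^ s <= n `^ s0 by apply: ler_powR.
have C0n : 2 * K * C0 < n `^ s0.
  have h1 : 2 * K ^+ 2 * C0 = K * (2 * K * C0) by ring.
  have : K * (2 * K * C0) < K * n `^ s by lra.
  by rewrite ltr_pM2l //; lra.
have thin (A' : {fset 'rV[rat]_d.+1}) i : (A' `<=` A)%fset -> n <= 2 * K * (#|` A'|)%:R ->
    (#|` sumset A' (apset N (row i W))| < #|` A'| * N)%N.
  move=> A'A hA'; rewrite -(ltr_nat R) natrM.
  have h1 : (#|` sumset A' (apset N (row i W))|)%:R <= N%:R * (C0 * n `^ (1 - s0)).
    apply: le_trans (hW i); rewrite ler_nat.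
    apply: (@card_le_inj _ _ (fun x => x + b *m g)); first by move=> x y _ _; apply: addIr.
    move=> x /sumsetP [u [v [uA vW ->]]]; rewrite addrAC; apply: mem_sumset => //.
    by apply: mem_tsum => //; move/fsubsetP: A'A; apply.
  apply: le_lt_trans h1 _; rewrite mulrC ltr_pM2r ?ltr0n // powB mulrA ltr_pdivrMr //.
  have h2 : 2 * K * (C0 * n) < n `^ s0 * n by rewrite mulrA ltr_pM2r.
  have h3 : n * n `^ s0 <= 2 * K * (#|` A'|)%:R * n `^ s0 by rewrite ler_pM2r.
  have K2 : 0 < 2 * K by lra.
  rewrite -(ltr_pM2l K2); lra.
have sK3 : K ^+ 2 * s <= K ^+ 3 * s.
  by apply: ler_wpM2r; [exact: ltW | rewrite (exprS K 2) ler_peMl ?exprn_ge0 //; lra].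
have sK2 : K * s <= K ^+ 2 * s.
  by apply: ler_wpM2r; [exact: ltW | rewrite expr2 ler_peMl //; lra].
have sK1 : s <= K * s by rewrite ler_peMl // ltW.
have [N1 [B1 [sG1 AG1 gen1 sub1]]] := diff_lattice bA intA.
have rk1 : \rank (ratmx B1) = d.+1.
  apply: (full_rank_of_thin uW _ sub1) => i; apply: thin; first exact: fsubset_refl.
  by rewrite -/n ler_peMl ?(ltW n0) //; lra.
have [ga1 ga1G ga1I] := coprime_index cop L10 rk1.
have [|A1 [c1 [[A1A A10] near1 cA1 A1L [c1A c1I _]]]] :=
  fill_step K1 D0 hs s1 ug A0 sG1 AG1 gen1 ga1G ga1I (lexx 0) _ hered near.
  by rewrite addr0; lra.
set e1 := 2 * K * (s + 0) in near1.
pose Lam1 x := in_lattice B1 x /\ in_lattice B1 (x *m g).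
have sL1 : subgroup Lam1.
  split; first by rewrite /Lam1 mul0mx; split; exact: sG1.1.
  move=> x y [x1 x2] [y1 y2]; split; first exact: sG1.2.
  by rewrite mulmxBl; apply: sG1.2.
have hered1 : subsets_bounded K D s g A1.
  move=> B BA1 BnA1; apply: hered; first exact: fsubset_trans A1A.
  apply: contra_neq BnA1 => e; apply/eqP; rewrite eqEfsubset BA1 /=.
  by rewrite e.
have [b1 b1A] := fset0Pn _ A10.
have intA1 : integral_set A1 by move=> a aA1; apply: intA; move/fsubsetP: A1A; apply.
have [N2 [B2 [sG2 AG2 gen2 sub2]]] := diff_lattice b1A intA1.
have rk2 : \rank (ratmx B2) = d.+1.
  by apply: (full_rank_of_thin uW _ sub2) => i; apply: thin.
have cop' : coprime_mats [:: L2; L1].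
  move=> [P [Q [uP uQ PQ0 PQ1 h]]]; apply: cop; exists P, Q; split=> // L hL; apply: h.
  by move: hL; rewrite !inE orbC.
have [ga2 ga2G ga2I] := coprime_index cop' L20 rk2.
rewrite -dilate_inv // -/g in ga2I.
have e1E : e1 = 2 * (K * s) by rewrite /e1 addr0; ring.
have Ks0 : 0 < K * s by apply: mulr_gt0 => //; lra.
have e10 : 0 <= e1 by rewrite e1E; lra.
have c2 : 4 * K ^+ 2 * (s + e1) <= 1.
  have -> : 4 * K ^+ 2 * (s + e1) = 4 * (K ^+ 2 * s) + 8 * (K ^+ 3 * s) by rewrite e1E; ring.
  lra.
have near1' := proj2 (near_counterexample_inv K D s e1 A1 ug) near1.
have [A2 [c2' [[A2A A20] near2 cA2 A2L [c2A c2I tr]]]] :=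
  fill_step K1 D0 hs s1 ug' A10 sG2 AG2 gen2 ga2G ga2I e10 c2 (subsets_bounded_inv ug hered1) near1'.
set e2 := 2 * K * (s + e1) in near2.
pose Lam2 x := in_lattice B2 x /\ in_lattice B2 (x *m invmx g).
have e2E : e2 = 2 * (K * s) + 4 * (K ^+ 2 * s) by rewrite /e2 e1E; ring.
have K2s0 : 0 < K ^+ 2 * s by apply: mulr_gt0 => //; apply: exprn_gt0; lra.
have e20 : 0 <= e2 by rewrite e2E; lra.
have hse2 : 4 * K * (s + e2) <= 1.
  have -> : 4 * K * (s + e2) = 4 * (K * s) + 8 * (K ^+ 2 * s) + 16 * (K ^+ 3 * s) by rewrite e2E; ring.
  lra.
have sL2 : subgroup Lam2.
  split; first by rewrite /Lam2 mul0mx; split; exact: sG2.1.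
  move=> x y [x1 x2] [y1 y2]; split; first exact: sG2.2.
  by rewrite mulmxBl; apply: sG2.2.
(* The [c1 p] were found in [A1]; the last clause of [fill_step] for [g^-1] replaces each by a point
   of [A2] with the same residue. *)
have trx p : exists x, (x \in A2) && `[< Lam2 ((c1 p - x) *m g) >].
  have [x xA2 h] := tr _ (c1A p); exists x; rewrite xA2; apply/asboolP.
  by move: h; rewrite invmxK.
pose c1' p := xchoose (trx p).
have c1'P p : c1' p \in A2 /\ Lam2 ((c1 p - c1' p) *m g).
  by have /andP [? /asboolP] := xchooseP (trx p).
have c1'I p q : Lam2 ((c1' p - c1' q) *m g) -> p = q.
  (* The lattice of [B2] is generated by [A1 - A1], so it lies in [Lam1], modulo which the [c1 p]
     are already separated. *)
  move=> h; apply: c1I; apply: (gen2 _ sL1 A1L).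
  have [_ hp] := c1'P p; have [_ hq] := c1'P q.
  suff : Lam2 ((c1 p - c1 q) *m g) by case.
  have -> : c1 p - c1 q = (c1' p - c1' q) + ((c1 p - c1' p) - (c1 q - c1' q)).
    have alg (P Q' u v : 'rV[rat]_d.+1) : (P - u) - (Q' - v) = (P - Q') - (u - v).
      by rewrite !opprB addrACA [RHS]addrACA [- u - Q']addrC.
    by rewrite alg [RHS]addrC subrK.
  by rewrite mulmxDl; apply: subgroupD => //; rewrite mulmxBl; apply: sL2.2.
have A2A0 : (A2 `<=` A)%fset by apply: fsubset_trans A1A.
have hered2 : subsets_bounded K D s g A2.
  move=> B BA BnA; apply: hered1; first exact: fsubset_trans A2A.
  by apply: contra_neq BnA => e; apply/eqP; rewrite eqEfsubset BA /= e.
have near2' := proj1 (near_counterexample_inv K D s e2 A2 ug) near2.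
pose E := M * n `^ (1 - s0).
have bm X Y x z : (X `<=` A2)%fset -> (Y `<=` A2)%fset -> X != fset0 -> Y != fset0 ->
     0 <= x -> 0 <= z -> x ^+ d.+1 <= (#|` X|)%:R -> z ^+ d.+1 <= (#|` Y|)%:R ->
     (x + z) ^+ d.+1 <= (#|` tsum g X Y|)%:R + E.
  move=> XA YA X0 Y0 x0 z0 hx hz; rewrite /E /M -mulrA.
  have ginj : injective (mulmxr g : 'rV_d.+1 -> 'rV_d.+1).
    by move=> u v /= e; rewrite -[u](mulmxK ug) e mulmxK.
  apply: (sumset_lower_bound (W := W) (N := N)) => //.
  - move=> i; apply: le_trans (hW i); rewrite ler_nat; apply: fsubset_leq_card.
    apply: sumsetS; last exact: fsubset_refl.
    by apply: tsumS; apply: fsubset_trans A2A0.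
  - have [v vY] := fset0Pn _ Y0; apply/fset0Pn; exists (mulmxr g v).
    by apply/imfsetP; exists v.
  - by rewrite card_imfset.
have A2gt0 : 0 < (#|` A2|)%:R :> R by rewrite ltr0n cardfs_gt0.
have A2n : (#|` A2|)%:R <= n by rewrite ler_nat fsubset_leq_card.
have nA2 : n <= 4 * K ^+ 2 * (#|` A2|)%:R.
  apply: le_trans cA1 _.
  have -> : 4 * K ^+ 2 * (#|` A2|)%:R = 2 * K * (2 * K * (#|` A2|)%:R) by ring.
  by rewrite ler_pM2l //; lra.
have hE m : (m <= m1 + m2)%N -> m%:R * E <= err D s A2 / (4 * K).
  move=> hm.
  have h1 := powR_frac_ge hs s1 A2gt0 A2n.
  have K4 : 0 < 4 * K by lra.
  have K42 : 0 < 4 * K ^+ 2 by rewrite mulr_gt0 // exprn_gt0 //; lra.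
  have h2 : n `^ (1 - s) <= 4 * K ^+ 2 * (#|` A2|)%:R `^ (1 - s).
    apply: (@le_trans _ _ (4 * K ^+ 2 * ((#|` A2|)%:R / n * n `^ (1 - s)))); last by rewrite ler_pM2l.
    have h0 : 1 <= 4 * K ^+ 2 * ((#|` A2|)%:R / n) by rewrite mulrA ler_pdivlMr // mul1r.
    by rewrite mulrA ler_peMl // powR_ge0.
  have h3 : n `^ (1 - s0) <= n `^ (1 - s) by apply: ler_powR => //; lra.
  have M0 : 0 <= M by rewrite mulr_ge0 // ltW.
  rewrite ler_pdivlMr // /err.
  rewrite -(ler_pM2l K42) [leRHS]mulrCA.
  apply: (@le_trans _ _ (D * n `^ (1 - s))); last by rewrite ler_pM2l.
  apply: (@le_trans _ _ (16 * K ^+ 3 * ((m1 + m2)%:R * M) * n `^ (1 - s))); last first.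
    by apply: ler_wpM2r => //; exact: powR_ge0.
  have -> : 4 * K ^+ 2 * (m%:R * E * (4 * K)) = 16 * K ^+ 3 * (m%:R * M) * n `^ (1 - s0).
    by rewrite /E; ring.
  have K30 : 0 <= 16 * K ^+ 3 by rewrite mulr_ge0 // exprn_ge0 //; lra.
  apply: ler_pM => //; rewrite ?powR_ge0 //.
    by apply: mulr_ge0 => //; apply: mulr_ge0.
  by apply: ler_wpM2l => //; apply: ler_wpM2r => //; rewrite ler_nat.
apply: (final_contradiction K1 D0 hs s1 e20 hse2 m10 m20 mu10 mu20 emu1 emu2 eK ug sL2 A2L
  hered2 near2' _ c1'I c2A c2I bm).
- by move=> p; case: (c1'P p).
- by apply: hE; exact: leq_addr.
- by apply: hE; exact: leq_addl.
Qed.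

Definition bm_const (R : realType) (d m1 m2 : nat) : R :=
  ((m1%:R) `^ (d%:R^-1) + (m2%:R) `^ (d%:R^-1)) ^+ d.

Lemma dilate_bound (R : realType) (d m1 m2 : nat) : (0 < m1)%N -> (0 < m2)%N ->
  exists D s : R, [/\ 0 < D, 0 < s & forall L1 L2 : 'M[int]_d.+1,
    irreducible_mats [:: L1; L2] -> coprime_mats [:: L1; L2] ->
    `|\det L1|%N = m1 -> `|\det L2|%N = m2 ->
    forall A, integral_set A -> bounded_below (bm_const R d.+1 m1 m2) D s (dilate L1 L2) A].
Proof.
move=> m10 m20.
pose mu m : R := m%:R `^ (d.+1%:R^-1).
have mu0 m : 0 <= mu m by apply: powR_ge0.
have muX m : mu m ^+ d.+1 = m%:R.
  by rewrite /mu -powR_mulrn ?powR_ge0 // -powRrM mulVf ?pnatr_eq0 // powRr1.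
have mule m : (0 < m)%N -> mu m <= m%:R.
  by move=> h; apply: ler1_powR; rewrite ?ler1n // invf_le1 ?ler1n // ltr0n.
have mu1 m : (0 < m)%N -> 1 <= mu m.
  by move=> h; rewrite -(@ler_pXn2r _ d.+1) ?nnegrE // expr1n muX ler1n.
set K := bm_const R d.+1 m1 m2.
have eK : K = (mu m1 + mu m2) ^+ d.+1 by [].
have K1 : 1 <= K.
  by rewrite eK; apply: exprn_ege1; have := mu1 _ m10; have := mu0 m2; lra.
(* An integer bound for [K], since the covering lemmas count in natural numbers; it depends only on
   [m1], [m2] and the dimension. *)
pose kappa := ((m1 + m2) ^ d.+1)%N.
have Kk : K <= kappa%:R.
  rewrite eK /kappa natrX natrD lerXn2r ?nnegrE ?addr_ge0 //.
  by apply: lerD; apply: mule.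
have k0 : (0 < kappa)%N by rewrite expn_gt0 addn_gt0 m10.
have [C0 [s0 [C00 s00 s01 smooth]]] := smooth_directions R d k0.
have K30 : 0 < 28 * K ^+ 3 by rewrite mulr_gt0 // exprn_gt0 //; lra.
pose s := Num.min s0 (28 * K ^+ 3)^-1.
have hs : 0 < s by rewrite lt_min s00 invr_gt0.
have ss0 : s <= s0 by rewrite ge_min lexx.
have sK : 28 * K ^+ 3 * s <= 1.
  by rewrite mulrC -ler_pdivlMr // div1r ge_min lexx orbT.
pose M := (2 ^ d.+1 * d.+1)%:R * C0.
have M0 : 0 < M by rewrite mulr_gt0 // ltr0n muln_gt0 expn_gt0.
pose D1 := 2 * K ^+ 2 * C0; pose D2 := 16 * K ^+ 3 * ((m1 + m2)%:R * M).
have D10 : 0 <= D1 by rewrite !mulr_ge0 ?exprn_ge0 //; lra.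
have D20 : 0 <= D2.
  by apply: mulr_ge0; [rewrite mulr_ge0 ?exprn_ge0 //; lra | rewrite mulr_ge0 // ltW].
pose D := K + D1 + D2.
have D0 : 0 < D by rewrite /D; lra.
exists D, s; split=> // L1 L2 irr cop e1 e2 A.
have L10 : \det L1 != 0 by rewrite -absz_gt0 e1.
have L20 : \det L2 != 0 by rewrite -absz_gt0 e2.
(* Strong induction on [|A|]: where the bound fails, all proper subsets satisfy it. *)
have [k] := ubnP #|` A|; elim: k A => // k IH A hk intA.
rewrite /bounded_below leNgt; apply/negP => near.
have near0 : near_counterexample K D s (dilate L1 L2) 0 A.
  by rewrite /near_counterexample subr0 mul1r.
have nearE : err D s A < K * (#|` A|)%:R.
  have : 0 <= (#|` tsum (dilate L1 L2) A A|)%:R :> R by []. move: near; lra.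
(* For at most one point the error term is at least [K |A|], because [D >= K]. *)
have A1 : (1 < #|` A|)%N.
  rewrite ltnNge; apply/negP; rewrite leq_eqVlt ltnS leqn0 => /orP [] /eqP e.
    by move: nearE; rewrite /err e powR1 !mulr1 /D; lra.
  move: nearE; rewrite /err e mulr0 ltNge => /negP; apply.
  by rewrite mulr_ge0 ?powR_ge0 // ltW.
have hT : (#|` tsum (dilate L1 L2) A A| <= kappa * #|` A|)%N.
  rewrite -(ler_nat R) natrM.
  have h1 : K * (#|` A|)%:R <= kappa%:R * (#|` A|)%:R by apply: ler_wpM2r.
  have h2 : 0 <= err D s A by rewrite mulr_ge0 ?powR_ge0 // ltW.
  by move: near; rewrite /near_counterexample; lra.
have [N [W [N0 uW] hW]] := smooth _ _ (dilate_unit L10 L20) (dilate_irreducible L10 irr) A1 hT.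
apply: (@minimal_counterexample R K D s C0 s0 (mu m1) (mu m2) d L1 L2 W N A) => //;
  rewrite ?e1 ?e2 ?muX //.
- by rewrite /D; lra.
- by rewrite -/D1 /D; lra.
- by rewrite -/M -/D2 /D; lra.
- move=> B BA BnA; apply: IH; last by move=> a aB; apply: intA; move/fsubsetP: BA; apply.
  rewrite -ltnS; apply: leq_trans hk; rewrite ltnS.
  by apply: fproper_ltn_card; rewrite fproperEneq BnA BA.
Qed.

(** * Back to integer matrices; singular determinants *)

Lemma card_lin_sumset d (L1 L2 : 'M[int]_d) (A : {fset 'cV[int]_d}) : \det L1 != 0 ->
  let A' := [fset ratmx a^T | a in A]%fset in
  #|` tsum (dilate L1 L2) A' A'| = #|` lin_sumset L1 L2 A|.
Proof.
move=> L10 A'; have u1 : (ratmx L1)^T \in unitmx by rewrite unitmx_tr unit_ratmx.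
pose f (z : 'cV[int]_d) := ratmx z^T *m invmx (ratmx L1)^T.
have finj : injective f.
  move=> x y e; apply: trmx_inj; apply: ratmx_inj.
  by rewrite -[LHS](mulmxKV u1) -/(f x) e mulmxKV.
have fE (a b : 'cV[int]_d) : f (L1 *m a + L2 *m b) = ratmx a^T + ratmx b^T *m dilate L1 L2.
  rewrite /f linearD /= ratmxD !trmx_mul !ratmxM !ratmx_tr mulmxDl mulmxK //.
  by rewrite /dilate mulmxA.
have <- : #|` [fset f z | z in lin_sumset L1 L2 A]%fset| = #|` lin_sumset L1 L2 A|.
  by apply: card_imfset.
congr #|` _|; apply/fsetP => z; apply/tsumP/imfsetP => /=.
  move=> [? [? [/imfsetP [a /= aA ->] /imfsetP [b /= bA ->] ->]]].
  exists (L1 *m a + L2 *m b); last by rewrite fE.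
  by apply/imfset2P; exists a => //; exists b.
move=> [? /imfset2P [a /= aA [b /= bA ->]] ->]; exists (ratmx a^T), (ratmx b^T).
by rewrite fE; split=> //; apply/imfsetP; [exists a | exists b].
Qed.

(** A kernel vector [u] of [L1] spans a line that [L1] kills and [L2] maps into the line of [L2 u],
    or of [u] if [L2 u = 0]. For [d > 1] lines are non-trivial subspaces. *)
Lemma singular_irreducible d (L1 L2 : 'M[int]_d) : (1 < d)%N ->
  \det L1 = 0 -> irreducible_mats [:: L1; L2] -> False.
Proof.
move=> d1 L10; apply.
have : ~~ row_free (ratmx L1)^T.
  by rewrite row_free_unit unitmx_tr unit_ratmx L10 eqxx.
rewrite -kermx_eq0 => /rowV0Pn [u /sub_kermxP uL u0].
have d0 : (0 < d)%N by apply: ltnW.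
pose sq (v : 'rV[rat]_d) : 'M[rat]_d := \matrix_(i < d) v.
have sqE v : (sq v :=: v)%MS.
  apply/eqmxP/andP; split; first by apply/row_subP => i; rewrite rowK.
  by rewrite -[X in (X <= _)%MS](rowK (fun=> v) (Ordinal d0)) row_sub.
pose w := if u *m (ratmx L2)^T == 0 then u else u *m (ratmx L2)^T.
have w0 : w != 0 by rewrite /w; case: ifPn.
exists (sq u), (sq w); rewrite !sqE !rank_rV u0 w0; split=> //.
move=> L; rewrite !inE (eqmxMr _ (sqE u)) => /orP [/eqP ->|/eqP ->].
  by rewrite uL sub0mx.
rewrite sqE /w; case: eqP => [->|_]; [exact: sub0mx | exact: submx_refl].
Qed.

(** Coprimality does the work: with [L1 = 0] and [L2 != 0], the factor [L2^-1] keeps both matrices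
    integral, so [|L2| <= 1], and it remains to see that multiplication by [L2] is injective. *)
Lemma singular_bound (L1 L2 : 'M[int]_1) (A : {fset 'cV[int]_1}) :
  coprime_mats [:: L1; L2] -> \det L1 = 0 ->
  (`|\det L2| * #|` A| <= #|` lin_sumset L1 L2 A|)%N.
Proof.
move=> cop; rewrite !det_mx11 => L10.
have L1z : L1 = 0 by apply/matrixP => i j; rewrite !ord1 L10 mxE.
have [->|L20] := eqVneq (L2 0 0) 0; first by rewrite mul0n.
have l20 : (L2 0 0)%:~R != 0 :> rat by rewrite intr_eq0.
have L2le : (absz (L2 0 0)%R <= 1)%N.
  rewrite leqNgt; apply/negP => gt1; apply: cop.
  exists ((L2 0 0)%:~R^-1)%:M, 1%:M.
  have dn : `|\det (((L2 0 0)%:~R^-1)%:M : 'M[rat]_1) * \det (1%:M : 'M[rat]_1)| = `|(L2 0 0)%:~R|^-1.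
    by rewrite det1 mulr1 det_scalar expr1 normfV.
  have l2gt : 1 < `|(L2 0 0)%:~R| :> rat.
    by rewrite -intr_norm -abszE (_ : 1 = 1%:~R) // ltr_int.
  split; rewrite ?unitmx1 //.
  - by rewrite unitmxE det_scalar expr1 unitfE invr_eq0.
  - by rewrite dn invr_gt0 normr_gt0.
  - by rewrite dn invf_lt1 // (lt_trans _ l2gt).
  - move=> L; rewrite !inE => /orP [/eqP ->|/eqP ->].
      by exists 0; rewrite L1z /ratmx map_mx0 mulmx0 mul0mx.
    exists 1%:M; rewrite mulmx1 mul_scalar_mx; apply/matrixP => i j.
    by rewrite !mxE !ord1 mulVf.
apply: (@leq_trans (1 * #|` A|)%N); first by rewrite leq_mul2r L2le orbT.
rewrite mul1n; apply: (@card_le_inj _ _ (fun b => L1 *m b + L2 *m b)); last first.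
  by move=> b bA; apply/imfset2P; exists b => //; exists b.
move=> x y _ _; rewrite L1z !mul0mx !add0r => /matrixP /(_ 0 0).
rewrite !mxE !big_ord1 => /(mulfI L20) e.
by apply/matrixP => i j; rewrite !ord1.
Qed.

Lemma lin_sumsetC d (L1 L2 : 'M[int]_d) A : lin_sumset L1 L2 A = lin_sumset L2 L1 A.
Proof.
by apply/fsetP => z; apply/imfset2P/imfset2P => -[a aA [b bA ->]];
  exists b => //; exists a => //; rewrite addrC.
Qed.

Theorem theorem1p3 (R : realType) (d : nat) (hd : (1 <= d)%N) (m1 m2 : nat) :
  exists D : R, exists sigma : R, 0 < D /\ 0 < sigma /\
    forall L1 L2 : 'M[int]_d,
      irreducible_mats [:: L1; L2] ->
      coprime_mats [:: L1; L2] ->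
      `|\det L1|%N = m1 -> `|\det L2|%N = m2 ->
      forall A : {fset 'cV[int]_d},
        ((#|` lin_sumset L1 L2 A|)%fset%:R : R) >=
          ((m1%:R) `^ (d%:R^-1) + (m2%:R) `^ (d%:R^-1)) ^+ d * (#|` A|)%fset%:R
          - D * ((#|` A|)%fset%:R) `^ (1 - sigma).
Proof.
case: d hd => // d _.
have [/andP [m10 m20]|] := boolP ((0 < m1)%N && (0 < m2)%N).
  have [D [s [D0 s0 bound]]] := dilate_bound R d m10 m20.
  exists D, s; split=> //; split=> // L1 L2 irr cop e1 e2 A.
  have L10 : \det L1 != 0 by rewrite -absz_gt0 e1.
  have := bound L1 L2 irr cop e1 e2 [fset ratmx a^T | a in A]%fset.
  rewrite /bounded_below /err card_lin_sumset // card_imfset /=; last first.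
    by move=> x y /ratmx_inj /trmx_inj.
  by apply=> a /imfsetP [z /= _ ->]; exists z^T.
rewrite negb_and -!eqn0Ngt => m12.
(* Some determinant is [0] here. For [d > 1] this contradicts irreducibility; for [d = 1] the bound
   holds even without subtracting the error term. *)
exists 1, 1; split=> //; split=> // L1 L2 irr cop e1 e2 A.
rewrite lerBlDr; apply: ler_wpDr; first by rewrite mul1r powR_ge0.
have irr' : irreducible_mats [:: L2; L1].
  move=> [U [V [h1 h2 h3 h4]]]; apply: irr; exists U, V; split=> // L hL; apply: h4.
  by move: hL; rewrite !inE orbC.
have cop' : coprime_mats [:: L2; L1].
  move=> [P [Q [uP uQ PQ0 PQ1 h]]]; apply: cop; exists P, Q; split=> // L hL; apply: h.
  by move: hL; rewrite !inE orbC.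
case: d L1 L2 irr cop e1 e2 A irr' cop' => [|d] L1 L2 irr cop e1 e2 A irr' cop'; last first.
  exfalso; case/orP: m12 => /eqP m0; [apply: (singular_irreducible _ _ irr) | apply: (singular_irreducible _ _ irr')] => //.
    by apply/eqP; rewrite -absz_eq0 e1 m0.
  by apply/eqP; rewrite -absz_eq0 e2 m0.
rewrite expr1 invr1 !powRr1 // -natrD -natrM ler_nat.
case/orP: m12 => /eqP m0.
  rewrite m0 add0n -e2; apply: singular_bound => //.
  by apply/eqP; rewrite -absz_eq0 e1 m0.
rewrite m0 addn0 -e1 lin_sumsetC; apply: singular_bound => //.
by apply/eqP; rewrite -absz_eq0 e2 m0.
Qed.
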